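(* For any $n\ge0$, $f_n\in\mathrm{Osc}_1(S_n)$ and $N\ge1$, $$N\,|\mathbb E(\eta_n^N(f_n))-\eta_n(f_n)|\le\sigma_{1,n},\qquad \sigma_{1,n}:=4\sum_{p=0}^nq_{p,n}^3\beta(\mathcal P_{p,n}).$$ Moreover, for any $m\ge1$, $$\sqrt N\,\mathbb E\big(|[\eta_n^N-\eta_n](f_n)|^m\big)^{1/m}\le\frac{1}{\sqrt N}b(2m)^2\sigma_{1,n}+b(m)\sigma_{2,n},\qquad \sigma_{2,n}:=2\sum_{p=0}^nq_{p,n}\beta(\mathcal P_{p,n}).$$
   Context: Let $(S_n)_{n\ge0}$ be measurable spaces, $\eta_0\in\mathcal P(S_0)$, $\mathcal M_n$ ($n\ge1$) Markov kernels from $S_{n-1}$ to $S_n$, and $\mathcal G_n:S_n\to(0,1)$ ($n\ge0$) measurable with $q_n:=\sup_{x,y}\mathcal G_n(x)/\mathcal G_n(y)<\infty$. Limiting flow: $\eta_{n+1}:=\Psi_n(\eta_n)\mathcal M_{n+1}$ with $\Psi_n(\mu)(dx):=\mathcal G_n(x)\mu(dx)/\mu(\mathcal G_n)$. Let $\mathcal Q_{p+1}(x,dy):=\mathcal G_p(x)\mathcal M_{p+1}(x,dy)$, $\mathcal Q_{p,n}:=\mathcal Q_{p+1}\cdots\mathcal Q_n$ ($\mathcal Q_{n,n}=\mathrm{Id}$), $\mathcal P_{p,n}(f):=\mathcal Q_{p,n}(f)/\mathcal Q_{p,n}(1)$, $q_{p,n}:=\sup_{x,y\in S_p}\mathcal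 Q_{p,n}(1)(x)/\mathcal Q_{p,n}(1)(y)$, $\beta(\mathcal P_{p,n}):=\sup_{f\in\mathrm{Osc}_1(S_n)}\mathrm{osc}(\mathcal P_{p,n}f)$, where $\mathrm{osc}(f)=\sup_{x,y}|f(x)-f(y)|$ and $\mathrm{Osc}_1(E)$ is the set of measurable functions on $E$ with oscillation at most $1$. Particle system: for $\mu\in\mathcal P(S_n)$, $\mathcal S_{n,\mu}(x,dy):=\mathcal G_n(x)\delta_x(dy)+(1-\mathcal G_n(x))\mathcal G_n(y)\mu(dy)/\mu(\mathcal G_n)$, $\mathcal K_{n+1,\mu}:=\mathcal S_{n,\mu}\mathcal M_{n+1}$; $\mathcal X_0^{(N,i)}$ i.i.d. $\eta_0$, and given $\mathcal X_n^{(N)}$ the $\mathcal X_{n+1}^{(N,i)}$ are conditionally independent with laws $\mathcal K_{n+1,\eta_n^N}(\mathcal X_n^{(N,i)},\cdot)$, $\eta_n^N:=\frac1N\sum_i\delta_{\mathcal X_n^{(N,i)}}$. Constants: $b(2m)^{2m}:=(2m)_m2^{-m}$, $b(2m+1)^{2m+1}:=\frac{(2m+1)_{(m+1)}}{\sqrt{m+1/2}}2^{-(m+1/2)}$, $(n)_k:=n!/(n-k)!$. *)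

(* Defs.v *)
From HB Require Import structures.
From mathcomp Require Import all_boot all_order all_algebra.
From mathcomp Require Import all_classical all_reals all_analysis.
Unset Printing Implicit Defensive.
Import Order.TTheory GRing.Theory Num.Theory.
Local Open Scope classical_set_scope.
Local Open Scope ring_scope.

Section FK.
Variables (R : realType) (d : nat -> measure_display)
  (S : forall n, measurableType (d n))
  (M : forall n, R.-pker (S n) ~> (S n.+1))   (* M n is \mathcal M_{n+1} *)
  (G : forall n, S n -> R).

Definition osc (E : Type) (f : E -> R) : R :=
  sup [set `|f x - f y| | x in [set: E] & y in [set: E]].
Definition Osc1 (n : nat) (f : S n -> R) : Prop :=
  measurable_fun [set: S n] f /\ forall x y, `|f x - f y| <= 1.

Definition Mop (n : nat) (f : S n.+1 -> R) : S n -> R :=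
  fun x => fine (\int[M n x]_y (f y)%:E).

Definition Qop (n : nat) (f : S n.+1 -> R) : S n -> R :=
  fun x => @G n x * Mop n f x.

(* Qk p k = Q_{p,k+p} = Q_{p+1} ... Q_{k+p};  Qk p 0 = Id *)
Fixpoint Qk (p k : nat) : (S (k + p) -> R) -> (S p -> R) :=
  match k return (S (k + p) -> R) -> (S p -> R) with
  | 0 => fun f => f
  | k'.+1 => fun f => Qk p k' (Qop (k' + p) f)
  end.

Definition Pk (p k : nat) (f : S (k + p) -> R) : S p -> R :=
  fun x => Qk p k f x / Qk p k (fun _ => 1) x.

Definition qk (p k : nat) : R :=
  sup [set Qk p k (fun _ => 1) x / Qk p k (fun _ => 1) y
      | x in [set: S p] & y in [set: S p]].

Definition betak (p k : nat) : R :=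
  sup [set osc _ (Pk p k f) | f in [set f | Osc1 (k + p) f]].

(* sigma_{1,n} and sigma_{2,n}; the p-th term uses n = (n - p) + p *)
Definition sigma1 (n : nat) : R :=
  4 * \sum_(p < n.+1) (qk p (n - p)) ^+ 3 * betak p (n - p).
Definition sigma2 (n : nat) : R :=
  2 * \sum_(p < n.+1) qk p (n - p) * betak p (n - p).

(* limiting flow, as a functional on bounded measurable test functions:
   eta_0(f) = \int f d eta0,  eta_{n+1}(f) = eta_n(G_n M_{n+1} f) / eta_n(G_n)
   i.e. eta_{n+1} = Psi_n(eta_n) M_{n+1}. *)
Fixpoint eta_flow (eta0 : probability (S 0) R) (n : nat) : (S n -> R) -> R :=
  match n return (S n -> R) -> R with
  | 0 => fun f => fine (\int[eta0]_x (f x)%:E)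
  | n'.+1 => fun f => eta_flow eta0 n' (Qop n' f) / eta_flow eta0 n' (@G n')
  end.

Definition emp (N : nat) (E : Type) (xs : 'I_N -> E) (h : E -> R) : R :=
  N%:R^-1 * \sum_(j < N) h (xs j).

(* K_{n+1, eta^N}(x, B) = S_{n,eta^N} M_{n+1} (x, B), eta^N empirical:
   G_n(x) M_{n+1}(x,B) + (1 - G_n(x)) eta^N(G_n M_{n+1}(.,B)) / eta^N(G_n) *)
Definition Kemp (n N : nat) (xs : 'I_N -> S n) (x : S n) (B : set (S n.+1)) : R :=
  @G n x * fine (M n x B)
  + (1 - @G n x) * (emp N (S n) xs (fun y => @G n y * fine (M n y B)) / emp N (S n) xs (@G n)).

End FK.
Arguments osc {R E}.
Arguments Osc1 {R d S n}.
Arguments Mop {R d S} M n.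
Arguments Qop {R d S} M G n.
Arguments Qk {R d S} M G p k.
Arguments Pk {R d S} M G p k.
Arguments qk {R d S} M G p k.
Arguments betak {R d S} M G p k.
Arguments sigma1 {R d S} M G n.
Arguments sigma2 {R d S} M G n.
Arguments eta_flow {R d S} M G eta0 n.
Arguments emp {R N E}.
Arguments Kemp {R d S} M G n {N}.

Definition bconst (R : realType) (m : nat) : R :=
  let k := m./2 in
  if odd m then
    (((m ^_ k.+1)%:R / Num.sqrt (k%:R + 2^-1)) * powR 2 (- (k%:R + 2^-1)))
      `^ (m%:R^-1)
  else ((m ^_ k)%:R * 2 ^- k) `^ (m%:R^-1).

(* Main.v *)
Require Import Defs.
From HB Require Import structures.
From mathcomp Require Import all_boot all_order all_algebra.
From mathcomp Require Import all_classical all_reals all_analysis.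
From mathcomp Require Import measurable_realfun ring lra zify.
Import Order.TTheory GRing.Theory Num.Theory.
Import numFieldNormedType.Exports.
Local Open Scope classical_set_scope.
Local Open Scope ring_scope.

Set Implicit Arguments.
Unset Strict Implicit.
Unset Printing Implicit Defensive.
Set Bullet Behavior "Strict Subproofs".

(** Write [nu_p] for the conditional mean of [eta_p^N] given the particles at time
    [p - 1]: it is [eta_0] for [p = 0] and [Psi(eta_{p-1}^N) M_p] otherwise, because
    [eta S_eta = Psi(eta)]. Since [nu_{p+1}(Q_{p+1,n} f) / nu_{p+1}(Q_{p+1,n} 1) =
    eta_p^N(Q_{p,n} f) / eta_p^N(Q_{p,n} 1)], the error [eta_n^N(f) - eta_n(f)]
    telescopes into the local errors [eta_p^N(Q_{p,n} f) / eta_p^N(Q_{p,n} 1) -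
    nu_p(Q_{p,n} f) / nu_p(Q_{p,n} 1)]. Each of these is a centred average of
    conditionally independent terms of size [2 q_{p,n} beta(P_{p,n})], which gives
    [sigma_2], minus a product of two such averages divided by a quantity at least
    [1 / q_{p,n}], which gives [sigma_1] by Cauchy-Schwarz. The moments of the
    averages are compared, one particle at a time and by convexity, with those of
    sums of random signs, whence the Gaussian constants [b(m)]. *)

(** * Gaussian moments and convexity *)

(** No conditional expectation is ever formed: [X_init] and [X_step] only give probabilities of
    rectangles, so conditioning is replaced by orthogonality. For every bounded [h] measurable in
    the past and in the particles before the k-th one, [h] is orthogonal to [f(Z_k) - K_k(f)]; this
    follows from a pi-lambda argument in [h] and uniform approximation in [f]. Powers of partial
    sums are such [h], which is all that the moment comparison asks for. A local error involves a
    single transition, so the joint law of two consecutive times is enough; different times are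
    combined by Minkowski.

    Constants: put [g = Q_{p,n}(1)], [u = P_{p,n}(f)], and write q, beta for [q_{p,n}],
    [beta(P_{p,n})]. The linear part of the ratio averages [(g / nu(g)) (u - nu(g u) / nu(g))], of
    size q beta, doubled by centring. The relative fluctuation of the denominator has terms of size
    2 q, and [nu(g) / mu(g)] is at most q, whence 2 q beta . 2 q . q = 4 q^3 beta. Cauchy-Schwarz
    takes both factors in [L^{2m}], whence [b(2m)^2]. *)

Section power_inequalities.
Context {R : realFieldType}.
Implicit Types (p q a b c s y : R) (m j : nat).

Lemma convex_exprn p q a b m : 0 <= p -> 0 <= q -> p + q = 1 ->
  0 <= a -> 0 <= b -> (p * a + q * b) ^+ m <= p * a ^+ m + q * b ^+ m.
Proof.
move=> p0 q0 pq a0 b0; elim: m => [|m IH]; first by rewrite !expr0 !mulr1 pq.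
rewrite !exprS.
apply: le_trans (_ : (p * a + q * b) * (p * a ^+ m + q * b ^+ m) <= _).
  by rewrite ler_wpM2l// addr_ge0 ?mulr_ge0.
(* [x] and [x ^+ m] are ordered alike on nonnegative reals; [p * q] times this product is exactly
   the gap left by the induction. *)
have mono : 0 <= (a - b) * (a ^+ m - b ^+ m).
  have [ab|/ltW ba] := leP a b.
    by apply: mulr_le0; rewrite subr_le0 // lerXn2r.
  by apply: mulr_ge0; rewrite subr_ge0 // lerXn2r.
have qE : q = 1 - p by rewrite -pq; ring.
have : 0 <= p * q * ((a - b) * (a ^+ m - b ^+ m)).
  by apply: mulr_ge0 => //; exact: mulr_ge0.
move=> h; rewrite -subr_ge0; apply: le_trans h _; rewrite le_eqVlt; apply/orP; left.
by apply/eqP; rewrite qE; ring.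
Qed.

(** Signs are free here: squaring first makes the arguments nonnegative, and the quadratic gap is
    [p * q * (a - b) ^+ 2]. *)
Lemma convex_exprn_even p q a b m : 0 <= p -> 0 <= q -> p + q = 1 ->
  (p * a + q * b) ^+ m.*2 <= p * a ^+ m.*2 + q * b ^+ m.*2.
Proof.
move=> p0 q0 pq; rewrite -!mul2n !exprM.
apply: le_trans (_ : (p * a ^+ 2 + q * b ^+ 2) ^+ m <= _).
  have qE : q = 1 - p by rewrite -pq; ring.
  apply: lerXn2r; rewrite ?nnegrE ?sqr_ge0//.
    by apply: addr_ge0; apply: mulr_ge0; rewrite ?sqr_ge0.
  have e : p * a ^+ 2 + q * b ^+ 2 - (p * a + q * b) ^+ 2 = p * q * (a - b) ^+ 2.
    by rewrite qE; ring.
  by rewrite -subr_ge0 e mulr_ge0 ?sqr_ge0// mulr_ge0.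
by apply: convex_exprn; rewrite ?sqr_ge0.
Qed.

(* A centred variable in [-c, c] is dominated, in convex order, by c times a
   random sign; this is the pointwise form of that comparison. *)
Lemma exprn_even_le_chord c s y m : 0 < c -> `|y| <= c ->
  (s + y) ^+ m.*2 <= 2^-1 * ((s + c) ^+ m.*2 + (s - c) ^+ m.*2)
    + (2^-1 * c^-1 * ((s + c) ^+ m.*2 - (s - c) ^+ m.*2)) * y.
Proof.
move=> c0; rewrite ler_norml => /andP[cy yc].
have c2 : 0 < 2 * c by rewrite mulr_gt0.
set p := (c + y) / (2 * c); set q := (c - y) / (2 * c).
have p0 : 0 <= p by rewrite divr_ge0 ?(ltW c2)// -lerBlDl sub0r.
have q0 : 0 <= q by rewrite divr_ge0 ?(ltW c2)// subr_ge0.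
have pq : p + q = 1 by rewrite /p /q; field; rewrite gt_eqF.
have -> : s + y = p * (s + c) + q * (s - c).
  by rewrite /p /q; field; rewrite gt_eqF.
apply: le_trans (convex_exprn_even (s + c) (s - c) m p0 q0 pq) _.
rewrite le_eqVlt; apply/orP; left; apply/eqP.
by rewrite /p /q; field; rewrite gt_eqF.
Qed.

Lemma sum_parity (F : nat -> R) m :
  \sum_(i < m.*2.+1) F i = \sum_(j < m.+1) F j.*2 + \sum_(j < m) F j.*2.+1.
Proof.
elim: m => [|m IH]; first by rewrite !big_ord_recr !big_ord0 /= addr0.
rewrite doubleS big_ord_recr big_ord_recr /= IH.
rewrite [in RHS]big_ord_recr /= [\sum_(j < m.+1) F j.*2.+1]big_ord_recr /= doubleS.
by ring.
Qed.

Lemma exprN2 c k : (- c) ^+ k.*2 = c ^+ k.*2.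
Proof. by rewrite -mul2n !exprM sqrrN. Qed.

(** Averaging over the sign of [c] cancels its odd powers. The sum is indexed by the power of [s] so
    that it can be compared term by term with a binomial expansion of
    [(c ^+ 2 + k%:R * c ^+ 2) ^+ m]. *)
Lemma exprn_even_part c s m :
  2^-1 * ((s + c) ^+ m.*2 + (s - c) ^+ m.*2) =
  \sum_(j < m.+1) ('C(m.*2, j.*2)%:R * c ^+ (m - j).*2 * s ^+ j.*2).
Proof.
rewrite !exprDn_comm; try exact: mulrC.
rewrite -big_split /= mulr_sumr.
rewrite (sum_parity (fun i => 2^-1 * ((s ^+ (m.*2 - i) * c ^+ i) *+ 'C(m.*2, i)
   + (s ^+ (m.*2 - i) * (- c) ^+ i) *+ 'C(m.*2, i)))) /=.
rewrite [X in _ + X]big1 ?addr0; last first.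
  move=> j _; rewrite 2!exprS exprN2 -[X in _ * (X + _)]mulr_natr.
  by rewrite -[X in _ * (_ + X)]mulr_natr; ring.
rewrite [RHS](reindex_inj rev_ord_inj) /=; apply: eq_bigr => -[j /= jm] _.
rewrite subSS; have jm' : (j <= m)%N by rewrite -ltnS.
rewrite subKn// -doubleB.
rewrite exprN2.
rewrite -(@bin_sub _ j.*2) ?leq_double// -doubleB.
rewrite -[X in _ * (X + _)]mulr_natr -[X in _ * (_ + X)]mulr_natr.
by field.
Qed.

End power_inequalities.

(** The moment of order 2m of a standard Gaussian variable, [(2m)! / (2^m m!)]. *)
Definition gauss_moment (R : realFieldType) (m : nat) : R :=
  (m.*2 ^_ m)%:R * 2 ^- m.
Arguments gauss_moment {R}.

Section gauss_moment.
Context {R : realFieldType}.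

Lemma gauss_momentE m : gauss_moment m * (m`!%:R * 2 ^+ m) = m.*2`!%:R :> R.
Proof.
rewrite /gauss_moment -(@ffact_fact m.*2 m) -?addnn ?leq_addr// addnK natrM.
by field; rewrite ?expf_neq0 ?pnatr_eq0.
Qed.

Lemma gauss_moment_gt0 m : 0 < gauss_moment m :> R.
Proof.
rewrite /gauss_moment mulr_gt0 ?invr_gt0 ?exprn_gt0// ltr0n ffact_gt0.
by rewrite -addnn leq_addr.
Qed.

Lemma fact_double_ge k : (k`! * 2 ^ k <= k.*2`!)%N.
Proof.
elim: k => // k IH; rewrite doubleS !factS expnS.
rewrite (_ : _ * _ = k.+1 * 2 * (k`! * 2 ^ k))%N; last by lia.
rewrite [leqRHS]mulnA; apply: leq_mul => //.
by rewrite muln2 doubleS leq_pmulr.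
Qed.

(** Once factorials are cleared, the right side is [gauss_moment (m - j)] times the left one, and
    this factor is at least 1 by [fact_double_ge]. The inequality closes the induction on the number
    of summands in the moment bound. *)
Lemma bin_gauss_moment m j : (j <= m)%N ->
  'C(m.*2, j.*2)%:R * gauss_moment j <= 'C(m, j)%:R * gauss_moment m :> R.
Proof.
move=> jm.
have jm2 : (j.*2 <= m.*2)%N by rewrite leq_double.
have f0 k : 0 < k`!%:R :> R by rewrite ltr0n fact_gt0.
have fn0 k : k`!%:R != 0 :> R by rewrite gt_eqF.
have gE k : gauss_moment k = k.*2`!%:R / (k`!%:R * 2 ^+ k) :> R.
  by rewrite -gauss_momentE mulfK// mulf_neq0 ?fn0 ?expf_neq0 ?pnatr_eq0.
have bE k l : (l <= k)%N -> 'C(k, l)%:R = k`!%:R / (l`!%:R * (k - l)`!%:R) :> R.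
  by move=> lk; rewrite -(bin_fact lk) !natrM mulfK// mulf_neq0.
have e2 : 2 ^+ m = 2 ^+ (m - j) * 2 ^+ j :> R by rewrite -exprD subnK.
rewrite !gE !bE// -doubleB e2.
have h : (m - j)`!%:R * 2 ^+ (m - j) <= (m - j).*2`!%:R :> R.
  by rewrite -natrX -natrM ler_nat fact_double_ge.
rewrite [leLHS](_ : _ = m.*2`!%:R / (j`!%:R * 2 ^+ j) * ((m - j).*2`!%:R)^-1).
  rewrite [leRHS](_ : _ = m.*2`!%:R / (j`!%:R * 2 ^+ j) * ((m - j)`!%:R * 2 ^+ (m - j))^-1).
    by rewrite ler_wpM2l ?divr_ge0 ?mulr_ge0 ?exprn_ge0 ?(ltW (f0 _))// lef_pV2 ?posrE ?mulr_gt0 ?exprn_gt0.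
  by field; rewrite ?fn0 ?expf_neq0 ?pnatr_eq0.
by field; rewrite ?fn0 ?expf_neq0 ?pnatr_eq0.
Qed.

End gauss_moment.

(** * Bounded measurable functions and their means *)

Section bounded_measurable.
Context {R : realType} {d} {T : measurableType d}.
Implicit Types (f g : T -> R).

(** Under a probability every such function is integrable, and the class is stable under the
    operations used below; only reciprocals call for a positive lower bound. *)
Definition bm f := measurable_fun [set: T] f /\ exists C, forall x, `|f x| <= C.

Lemma eq_bm f g : f =1 g -> bm f -> bm g.
Proof. by move=> /funext ->. Qed.

Lemma bm_cst c : bm (fun=> c).
Proof. by split; [exact: measurable_cst | exists `|c|]. Qed.

Lemma bmD f g : bm f -> bm g -> bm (fun x => f x + g x).
Proof.
move=> [mf [C fC]] [mg [D gD]]; split; first exact: measurable_funD.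
by exists (C + D) => x; rewrite (le_trans (ler_normD _ _))// lerD.
Qed.

Lemma bmM f g : bm f -> bm g -> bm (fun x => f x * g x).
Proof.
move=> [mf [C fC]] [mg [D gD]]; split; first exact: measurable_funM.
by exists (C * D) => x; rewrite normrM ler_pM.
Qed.

Lemma bmZ c f : bm f -> bm (fun x => c * f x).
Proof. by move=> bf; apply: bmM => //; exact: bm_cst. Qed.

Lemma bmN f : bm f -> bm (fun x => - f x).
Proof. by move=> bf; apply: eq_bm (bmZ (-1) bf) => x; rewrite mulN1r. Qed.

Lemma bmB f g : bm f -> bm g -> bm (fun x => f x - g x).
Proof. by move=> bf bg; apply: bmD => //; exact: bmN. Qed.

Lemma bm_sum I (r : seq I) (Q : pred I) (F : I -> T -> R) :
  (forall i, Q i -> bm (F i)) -> bm (fun x => \sum_(i <- r | Q i) F i x).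
Proof.
move=> bF; elim: r => [|i r IH].
  by apply: eq_bm (bm_cst 0) => x; rewrite big_nil.
case: (boolP (Q i)) => Qi.
  by apply: eq_bm (bmD (bF i Qi) IH) => x; rewrite big_cons Qi.
by apply: eq_bm IH => x; rewrite big_cons (negbTE Qi).
Qed.

Lemma bm_prod I (r : seq I) (F : I -> T -> R) :
  (forall i, bm (F i)) -> bm (fun x => \prod_(i <- r) F i x).
Proof.
move=> bF; elim: r => [|i r IH].
  by apply: eq_bm (bm_cst 1) => x; rewrite big_nil.
by apply: eq_bm (bmM (bF i) IH) => x; rewrite big_cons.
Qed.

Lemma bmX f n : bm f -> bm (fun x => f x ^+ n).
Proof.
move=> bf; elim: n => [|n IH]; first exact: eq_bm (bm_cst 1).
by apply: eq_bm (bmM bf IH) => x; rewrite exprS.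
Qed.

Lemma bm_norm f : bm f -> bm (fun x => `|f x|).
Proof.
move=> [mf [C fC]]; split; first exact: measurableT_comp.
by exists C => x; rewrite normr_id.
Qed.

Lemma bmV f c : 0 < c -> (forall x, c <= f x) -> bm f -> bm (fun x => (f x)^-1).
Proof.
move=> c0 cf [mf _]; split; last first.
  exists c^-1 => x; have fx := lt_le_trans c0 (cf x).
  by rewrite ger0_norm ?invr_ge0 ?(ltW fx)// lef_pV2.
have oN0 : open [set x : R | x != 0] by exact: open_neq.
apply: (@measurable_comp _ _ _ _ _ _ [set x : R | x != 0]) => //.
- exact: open_measurable.
- by move=> _ /= [x _ <-]; rewrite gt_eqF// (lt_le_trans c0).
- apply: subspace_continuous_measurable_fun; first exact: open_measurable.
  by apply: continuous_in_subspaceT => x; rewrite inE /= => x0; exact: inv_continuous.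
Qed.

Lemma bm_indic A : measurable A -> bm (\1_A : T -> R).
Proof.
move=> mA; split; first exact: measurable_indic.
by exists 1 => x; rewrite indicE; case: (_ \in _); rewrite ?normr1 ?normr0.
Qed.

End bounded_measurable.

Lemma bm_comp {R : realType} {d d'} {T : measurableType d} {U : measurableType d'}
    (Z : U -> T) (f : T -> R) :
  measurable_fun [set: U] Z -> bm f -> bm (fun x => f (Z x)).
Proof.
by move=> mZ [mf [C fC]]; split; [exact: measurableT_comp | exists C => x].
Qed.

Section expectation.
Context {R : realType} {d} {T : measurableType d}.
Variable mu : {measure set T -> \bar R}.
Hypothesis mu1 : mu [set: T] = 1%E.
Implicit Types (f g : T -> R).

Lemma bm_integrable f : bm f -> mu.-integrable [set: T] (EFin \o f).
Proof.
move=> [mf [C fC]].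
apply: (@le_integrable _ _ _ mu _ _ _ (EFin \o (fun=> C))) => //.
- exact/measurable_EFinP.
- by move=> x _ /=; rewrite lee_fin; exact: le_trans (fC x) (ler_norm C).
- apply/integrableP; split; first exact/measurable_EFinP/measurable_cst.
  by rewrite /= integral_cst// mu1 mule1 ltry.
Qed.

Lemma ExD f g : bm f -> bm g ->
  \int[mu]_x (f x + g x) = \int[mu]_x f x + \int[mu]_x g x.
Proof. by move=> bf bg; apply: RintegralD => //; exact: bm_integrable. Qed.

Lemma ExB f g : bm f -> bm g ->
  \int[mu]_x (f x - g x) = \int[mu]_x f x - \int[mu]_x g x.
Proof. by move=> bf bg; apply: RintegralB => //; exact: bm_integrable. Qed.

Lemma ExZ c f : bm f -> \int[mu]_x (c * f x) = c * \int[mu]_x f x.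
Proof. by move=> bf; apply: RintegralZl => //; exact: bm_integrable. Qed.

Lemma Ex_cst c : \int[mu]_(_ in [set: T]) c = c.
Proof. by rewrite Rintegral_cst// mu1 mulr1. Qed.

Lemma le_Ex f g : bm f -> bm g -> (forall x, f x <= g x) ->
  \int[mu]_x f x <= \int[mu]_x g x.
Proof.
by move=> bf bg fg; apply: le_Rintegral => //; exact: bm_integrable.
Qed.

Lemma eq_Ex f g : f =1 g -> \int[mu]_x f x = \int[mu]_x g x.
Proof. by move=> /funext ->. Qed.

Lemma Ex_ge0 f : (forall x, 0 <= f x) -> 0 <= \int[mu]_x f x.
Proof. by move=> f0; apply: Rintegral_ge0. Qed.

Lemma le_norm_Ex f : bm f -> `|\int[mu]_x f x| <= \int[mu]_x `|f x|.
Proof. by move=> bf; apply: le_normr_Rintegral => //; exact: bm_integrable. Qed.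

Lemma Ex_le f c : bm f -> (forall x, f x <= c) -> \int[mu]_x f x <= c.
Proof. by move=> bf fc; rewrite -(Ex_cst c) le_Ex//; exact: bm_cst. Qed.

Lemma Ex_sum I (r : seq I) (Q : pred I) (F : I -> T -> R) :
  (forall i, Q i -> bm (F i)) ->
  \int[mu]_x (\sum_(i <- r | Q i) F i x) = \sum_(i <- r | Q i) \int[mu]_x F i x.
Proof.
move=> bF; elim: r => [|i r IH].
  by rewrite big_nil -[RHS]Ex_cst; apply: eq_Ex => x; rewrite big_nil.
rewrite big_cons -IH; case: (boolP (Q i)) => Qi.
  rewrite -ExD; [|exact: bF|exact: bm_sum].
  by apply: eq_Ex => x; rewrite big_cons Qi.
by apply: eq_Ex => x; rewrite big_cons (negbTE Qi).
Qed.

Lemma Ex_indic A : measurable A -> \int[mu]_x (\1_A x) = fine (mu A).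
Proof. by move=> mA; rewrite /Rintegral integral_indic// setIT. Qed.

End expectation.

(** * Uniform approximation by combinations of indicators *)

Section uniform_density.
Context {R : realType} {d} {T : measurableType d}.

(** The integer part of [t] when [0 <= t <= n], written as a sum of indicators of superlevel
    sets. *)
Let levels (n : nat) (t : R) : R := \sum_(j < n) ((j.+1%:R <= t)%R)%:R.

Let levelsP n t : 0 <= t <= n%:R -> levels n t <= t <= levels n t + 1.
Proof.
rewrite /levels; elim: n t => [|n IH] t /andP[t0 tn].
  by rewrite big_ord0 add0r t0 (le_trans tn).
rewrite big_ord_recr/=; have [nt|tn'] := leP n.+1%:R t; last first.
  rewrite addr0; have [tn2|nt] := leP t n%:R; first by apply: IH; rewrite t0.
  rewrite (eq_bigr (fun=> 1)) => [|[i /= ni] _].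
    by rewrite sumr_const card_ord (ltW nt) /= -natr1 in tn' *; exact: ltW.
  by rewrite (le_trans _ (ltW nt)) ?ler_nat.
rewrite (eq_bigr (fun=> 1)) => [|[i /= ni] _].
  by rewrite sumr_const card_ord natr1 nt (le_trans tn)//= lerDl.
by rewrite (le_trans _ nt) ?ler_nat//ltnW.
Qed.

(* Bounded measurable functions are the uniform closure of the span of the
   indicators. *)
Lemma bm_ind (H : (T -> R) -> Prop) :
  (forall A, measurable A -> H \1_A) ->
  (forall f g, bm f -> bm g -> H f -> H g -> H (fun x => f x + g x)) ->
  (forall c f, bm f -> H f -> H (fun x => c * f x)) ->
  (forall f, bm f ->
     (forall e, 0 < e -> exists g, [/\ bm g, H g & forall x, `|f x - g x| <= e]) ->
     H f) ->
  forall f, bm f -> H f.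
Proof.
move=> H1 HD HZ Hunif f bf; apply: (Hunif f bf) => e e0.
have [mf [C0 fC0]] := bf.
pose C := Num.max C0 1; have C1 : 0 < C by rewrite lt_max ltr01 orbT.
have fC x : `|f x| <= C by rewrite le_max fC0.
(* [f] ranges in an interval of length [2 * C]; with [n] equal pieces, rounding down costs at most
   [2 * C / n < e]. *)
pose n := (Num.truncn (2 * C / e)).+1.
have nP : 2 * C / e < n%:R by rewrite truncnS_gt.
have n0 : 0 < n%:R :> R by rewrite ltr0n.
pose t x := (f x + C) * (n%:R / (2 * C)).
have tP x : 0 <= t x <= n%:R.
  have := fC x; rewrite ler_norml => /andP[h1 h2].
  rewrite mulr_ge0 ?divr_ge0 ?mulr_ge0 ?(ltW C1)//=; last by rewrite -lerBlDr sub0r.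
  by rewrite /t mulrCA ler_piMr// ler_pdivrMr ?mulr_gt0//; lra.
have mt : measurable_fun setT t.
  by apply: measurable_funM => //; apply: measurable_funD.
have mA (j : nat) : measurable [set x | j%:R <= t x].
  rewrite -[X in measurable X]setTI.
  rewrite (_ : [set x | _] = t @^-1` `[j%:R, +oo[%classic).
    by apply: mt => //; exact: measurable_itv.
  by apply/seteqP; split=> x /=; rewrite in_itv /= andbT.
pose g x := (2 * C / n%:R) * \sum_(j < n) \1_[set x | j.+1%:R <= t x] x - C.
have Hs k : H (fun x => \sum_(j < k) \1_[set x | j.+1%:R <= t x] x : R) /\
    bm (fun x => \sum_(j < k) \1_[set x | j.+1%:R <= t x] x : R).
  elim: k => [|k [IH1 IH2]].
    split; last by apply: eq_bm (bm_cst 0) => x; rewrite big_ord0.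
    rewrite (_ : (fun x => _) = (fun x => 0 * \1_[set: T] x)); last first.
      by apply/funext => x; rewrite big_ord0 mul0r.
    by apply: HZ; [exact: bm_indic|exact: H1].
  rewrite (_ : (fun x => _) = (fun x => \sum_(j < k) \1_[set x | j.+1%:R <= t x] x + \1_[set x | k.+1%:R <= t x] x)); last first.
    by apply/funext => x; rewrite big_ord_recr.
  split; first by apply: HD => //; [exact: bm_indic|exact: H1].
  by apply: bmD => //; exact: bm_indic.
have bT : bm (\1_[set: T] : T -> R) by exact: bm_indic.
exists g; split; last first.
- move=> x; rewrite /g.
  rewrite (_ : \sum_(j < n) _ = levels n (t x)); last first.
    by apply: eq_bigr => j _; rewrite indicE; congr (nat_of_bool _)%:R; apply/idP/idP; rewrite inE.
  have /andP[h1 h2] := levelsP (tP x).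
  have fE : f x = (2 * C / n%:R) * t x - C by rewrite /t; field; rewrite !gt_eqF.
  rewrite fE (_ : _ - _ = (2 * C / n%:R) * (t x - levels n (t x))); last by ring.
  have h0 : 0 <= 2 * C / n%:R by rewrite divr_ge0 ?mulr_ge0// ltW.
  rewrite normrM ger0_norm//.
  apply: le_trans (_ : 2 * C / n%:R * 1 <= _).
    by rewrite ler_wpM2l// ger0_norm ?subr_ge0// lerBlDl.
  by rewrite mulr1 ler_pdivrMr// -ler_pdivrMl// mulrC ltW.
- rewrite (_ : g = (fun x => (2 * C / n%:R) * \sum_(j < n) \1_[set x | j.+1%:R <= t x] x + - C * \1_[set: T] x)).
    have [Hsn bsn] := Hs n.
    by apply: HD; [exact: bmZ|exact: bmZ|exact: HZ|apply: HZ => //; exact: H1].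
  by apply/funext => x; rewrite indicT mulr1.
- by apply: bmB; [apply: bmZ; exact: (Hs n).2|exact: bm_cst].
Qed.

End uniform_density.

(** * Orthogonality extended from a pi-system to its sigma-algebra *)

Section orthogonality.
Context {R : realType} {d} {T : measurableType d}.
Variable mu : {measure set T -> \bar R}.
Hypothesis mu1 : mu [set: T] = 1%E.
Implicit Types (RR : set (set T)).

(** Measurability for a sub-sigma-algebra is expressed by retyping the domain:
    [g_sigma_algebraType RR] has the same points as [T]. *)
Lemma bm_sub RR (f : g_sigma_algebraType RR -> R) :
  RR `<=` measurable -> bm f -> bm (f : T -> R).
Proof.
move=> RRm [mf bf]; split=> // _ B mB; apply: (smallest_sub _ RRm); last exact: mf.
by split=> [|A|A]; [exact: measurable0|rewrite setTD; exact: measurableC|exact: bigcupT_measurable].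
Qed.

(** Boundedness of [W] reduces continuity from below of the signed set function to that of [mu]: the
    error is at most [C * (mu U - mu (F n))]. *)
Lemma Ex_indicM_continuous (W : T -> R) (F : (set T)^nat) : bm W ->
  (forall i, measurable (F i)) -> nondecreasing_seq F ->
  (forall i, \int[mu]_x (\1_(F i) x * W x) = 0) ->
  \int[mu]_x (\1_(\bigcup_i F i) x * W x) = 0.
Proof.
move=> bW mF ndF F0; set U := \bigcup_i F i.
have mU : measurable U by exact: bigcupT_measurable.
have mufin A : measurable A -> mu A \is a fin_num.
  move=> mA; rewrite ge0_fin_numE// (le_lt_trans (_ : _ <= mu setT)%E)//.
    by apply: le_measure; rewrite ?inE.
  by rewrite mu1 ltry.
have [_ [C0 WC0]] := bW; pose C := Num.max C0 1.
have C1 : 0 < C by rewrite lt_max ltr01 orbT.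
have WC x : `|W x| <= C by rewrite le_max WC0.
apply/eqP; rewrite -normr_le0; apply/ler_addgt0Pr => e e0; rewrite add0r.
have /fine_cvgP[_ cv] : mu \o F @ \oo --> (fine (mu U))%:E.
  by rewrite fineK ?mufin//; exact: nondecreasing_cvg_mu.
have eC : 0 < e / C by rewrite divr_gt0.
have /cvgrPdist_le/(_ _ eC)[n _ /(_ n (leqnn n))/= hn] := cv.
have bI A : measurable A -> bm (\1_A : T -> R) by exact: bm_indic.
have FU : F n `<=` U by move=> x Fx; exists n.
rewrite -[X in `|X|]subr0 -(F0 n) -ExB//; [|by apply: bmM => //; exact: bI..].
apply: le_trans (le_norm_Ex mu1 _) _; first by apply: bmB; apply: bmM => //; exact: bI.
apply: le_trans (_ : \int[mu]_x (C * (\1_U x - \1_(F n) x)) <= _).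
{ apply: le_Ex => //.
  - by apply: bm_norm; apply: bmB; apply: bmM => //; exact: bI.
  - by apply: bmZ; apply: bmB; exact: bI.
  - move=> x; rewrite -mulrBl normrM mulrC ler_pM//.
    rewrite ger0_norm// subr_ge0 !indicE ler_nat.
    by case: (boolP (x \in F n)) => // /set_mem/FU/mem_set ->. }
rewrite ExZ; [|by []|by apply: bmB; exact: bI].
rewrite ExB; [|by []|exact: bI|exact: bI].
rewrite !Ex_indic//.
rewrite mulrC -ler_pdivlMr//; apply: le_trans hn; exact: ler_norm.
Qed.

(* Dynkin's pi-lambda argument followed by functional induction. *)
Lemma Ex_orthogonal RR (W : T -> R) (f : g_sigma_algebraType RR -> R) :
  setI_closed RR -> RR setT -> RR `<=` measurable -> bm W ->
  (forall A, RR A -> \int[mu]_x (\1_A x * W x) = 0) -> bm f ->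
  \int[mu]_x (f x * W x) = 0.
Proof.
move=> RRI RRT RRm bW RR0 bf.
have bI A : measurable A -> bm (\1_A : T -> R) by exact: bm_indic.
pose H := [set A : set T | measurable A /\ \int[mu]_x (\1_A x * W x) = 0].
have lamH : lambda_system setT H.
{ split.
  - by [].
  - by split=> //; exact: RR0.
  - move=> A B BA [mA A0] [mB B0]; split; first exact: measurableD.
    rewrite -[RHS](subrr 0) -{1}A0 -{1}B0 -ExB; [|by []|by apply: bmM => //; exact: bI..].
    apply: eq_Ex => x; rewrite -mulrBl; congr (_ * _).
    rewrite !indicE in_setD; have := BA x.
    case: (boolP (x \in B)) => xB; case: (boolP (x \in A)) => xA //=;
      rewrite ?subr0 ?subrr//.
    by move=> h; case/negP: xA; apply/mem_set/h/set_mem.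
  - move=> F ndF HF; split; first by apply: bigcupT_measurable => i; case: (HF i).
    by apply: Ex_indicM_continuous => // i; case: (HF i). }
have RRH : RR `<=` H by move=> A RA; split; [exact: RRm|exact: RR0].
have sH : <<s RR >> `<=` H by exact: (lambda_system_subset RRI lamH RRH).
have EMb (g : g_sigma_algebraType RR -> R) : bm g -> bm (fun x : T => g x * W x).
  by move=> bg; apply: bmM => //; exact: bm_sub bg.
move: f bf; apply: bm_ind.
- by move=> A /sH[].
- move=> f g bf bg f0 g0; rewrite -[RHS](addr0 0) -{1}f0 -{1}g0 -ExD; [|by []|exact: EMb|exact: EMb].
  by apply: eq_Ex => x; rewrite mulrDl.
- move=> c f bf f0; rewrite -[RHS](mulr0 c) -f0 -ExZ; [|by []|exact: EMb].
  by apply: eq_Ex => x; rewrite mulrA.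
- move=> f bf hf; have [_ [C0 WC0]] := bW; pose C := Num.max C0 1.
  have C1 : 0 < C by rewrite lt_max ltr01 orbT.
  have WC x : `|W x| <= C by rewrite le_max WC0.
  apply/eqP; rewrite -normr_le0; apply/ler_addgt0Pr => e e0; rewrite add0r.
  have eC : 0 < e / C by rewrite divr_gt0.
  have [g [bg g0 fg]] := hf _ eC.
  rewrite -[X in `|X|]subr0 -{1}g0 -ExB; [|by []|exact: EMb|exact: EMb].
  apply: le_trans (le_norm_Ex mu1 _) _; first by apply: bmB; exact: EMb.
  apply: Ex_le => //; first by apply: bm_norm; apply: bmB; exact: EMb.
  move=> x; rewrite -mulrBl normrM -[leRHS](@divfK _ C) ?gt_eqF//.
  by rewrite ler_pM.
Qed.

End orthogonality.

Lemma powR_invnK {R : realType} m (x : R) : (0 < m)%N -> 0 <= x -> (x `^ (m%:R^-1)) ^+ m = x.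
Proof.
move=> m0 x0; rewrite -powR_mulrn ?powR_ge0// -powRrM mulVf ?powRr1//.
by rewrite pnatr_eq0 -lt0n.
Qed.

(** * Cauchy-Schwarz and Minkowski inequalities *)

Section moment_inequalities.
Context {R : realType} {d} {T : measurableType d}.
Variable mu : {measure set T -> \bar R}.
Hypothesis mu1 : mu [set: T] = 1%E.
Implicit Types (f g : T -> R).

Lemma Ex_cauchy_schwarz f g : bm f -> bm g ->
  (\int[mu]_x (f x * g x)) ^+ 2 <=
  (\int[mu]_x (f x ^+ 2)) * (\int[mu]_x (g x ^+ 2)).
Proof.
move=> bf bg; set c := \int[mu]_x (f x * g x).
set a := \int[mu]_x (f x ^+ 2); set b := \int[mu]_x (g x ^+ 2).
have a0 : 0 <= a by apply: Ex_ge0 => x; exact: sqr_ge0.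
have b0 : 0 <= b by apply: Ex_ge0 => x; exact: sqr_ge0.
have bff := bmX 2 bf; have bgg := bmX 2 bg; have bfg := bmM bf bg.
have key t : 0 <= a - 2 * t * c + t ^+ 2 * b.
  have : 0 <= \int[mu]_x ((f x - t * g x) ^+ 2) by apply: Ex_ge0 => x; exact: sqr_ge0.
  congr (0 <= _); rewrite /a /b /c -!ExZ//.
  rewrite -ExB//; last exact: bmZ.
  rewrite -ExD//; [|by apply: bmB => //; exact: bmZ|exact: bmZ].
  by apply: eq_Ex => x; ring.
have [b0'|bn0] := eqVneq b 0.
  rewrite b0' mulr0; have [->|cn0] := eqVneq c 0; first by rewrite expr0n.
  (* For [b = 0] the expression in [key] is affine in [t], and this [t] brings it down to -1. *)
  have := key ((a + 1) / (2 * c)); rewrite b0' mulr0 addr0.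
  rewrite (_ : _ - _ = -1) ?oppr_ge0 ?ler10//.
  by field.
have bp : 0 < b by rewrite lt_def bn0.
have := key (c / b); rewrite (_ : _ + _ = (a * b - c ^+ 2) / b); last by field.
by rewrite pmulr_lge0 ?invr_gt0// subr_ge0.
Qed.

Definition Lm (m : nat) f : R := (\int[mu]_x (`|f x| ^+ m)) `^ (m%:R^-1).

Lemma Lm_le m f a : (0 < m)%N -> 0 <= a ->
  (Lm m f <= a) = (\int[mu]_x (`|f x| ^+ m) <= a ^+ m).
Proof.
move=> m0 a0; rewrite /Lm; set e := Rintegral _ _ _.
have e0 : 0 <= e by apply: Ex_ge0 => x; exact: exprn_ge0.
by rewrite -{2}(powR_invnK m0 e0) ler_pXn2r// nnegrE powR_ge0.
Qed.

Lemma Lm_ge0 m f : 0 <= Lm m f. Proof. exact: powR_ge0. Qed.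

Lemma LmN m f : Lm m (fun x => - f x) = Lm m f.
Proof. by congr (_ `^ _); apply: eq_Ex => x; rewrite normrN. Qed.

(** [(|f| + |g|) / (a + b)] is a convex combination of [|f| / a] and [|g| / b], whose m-th moments
    are at most 1. Enlarging both bounds by [e / 2] keeps the denominators positive. *)
Lemma Lm_minkowski m f g a b : (0 < m)%N -> bm f -> bm g ->
  Lm m f <= a -> Lm m g <= b -> Lm m (fun x => f x + g x) <= a + b.
Proof.
move=> m0 bf bg fa gb; apply/ler_addgt0Pr => e e0.
have a0 := le_trans (Lm_ge0 m f) fa; have b0 := le_trans (Lm_ge0 m g) gb.
pose a' := a + e / 2; pose b' := b + e / 2.
have ap : 0 < a' by rewrite ltr_wpDl// divr_gt0.
have bp : 0 < b' by rewrite ltr_wpDl// divr_gt0.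
have abp : 0 < a' + b' by exact: addr_gt0.
have -> : a + b + e = a' + b' by rewrite /a' /b'; field.
have fa' : \int[mu]_x (`|f x| ^+ m) <= a' ^+ m.
  by rewrite -(Lm_le f m0 (ltW ap)) (le_trans fa)// lerDl divr_ge0// ltW.
have gb' : \int[mu]_x (`|g x| ^+ m) <= b' ^+ m.
  by rewrite -(Lm_le g m0 (ltW bp)) (le_trans gb)// lerDl divr_ge0// ltW.
rewrite (Lm_le _ m0 (ltW abp)).
have bfm : bm (fun x => `|f x| ^+ m) by apply: bmX; exact: bm_norm.
have bgm : bm (fun x => `|g x| ^+ m) by apply: bmX; exact: bm_norm.
pose p := a' / (a' + b'); pose q := b' / (a' + b').
have pq : p + q = 1 by rewrite /p /q -mulrDl divff// gt_eqF.
have p0 : 0 <= p by rewrite divr_ge0// ltW.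
have q0 : 0 <= q by rewrite divr_ge0// ltW.
apply: le_trans (_ : \int[mu]_x ((a' + b') ^+ m * (p / a' ^+ m * `|f x| ^+ m + q / b' ^+ m * `|g x| ^+ m)) <= _).
{ apply: le_Ex => //.
  - by apply: bmX; apply: bm_norm; exact: bmD.
  - by apply: bmZ; apply: bmD; exact: bmZ.
  - move=> x; apply: le_trans (_ : (`|f x| + `|g x|) ^+ m <= _).
      by apply: lerXn2r; rewrite ?nnegrE ?addr_ge0 ?ler_normD.
    have -> : `|f x| + `|g x| = (a' + b') * (p * (`|f x| / a') + q * (`|g x| / b')).
      by rewrite /p /q; field; rewrite !gt_eqF.
    rewrite exprMn ler_wpM2l ?exprn_ge0 ?(ltW abp)//.
    apply: le_trans (convex_exprn m p0 q0 pq _ _) _; rewrite ?divr_ge0 ?(ltW ap) ?(ltW bp)//.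
    by rewrite !expr_div_n (mulrCA p) (mulrCA q) ![`|_| ^+ m * _]mulrC. }
rewrite ExZ//; last by apply: bmD; exact: bmZ.
rewrite ExD//; [|exact: bmZ..].
rewrite !ExZ// -[leRHS]mulr1 ler_wpM2l ?exprn_ge0 ?(ltW abp)// -pq lerD//.
  by rewrite -mulrA ler_piMr// mulrC ler_pdivrMr ?mul1r// exprn_gt0.
by rewrite -mulrA ler_piMr// mulrC ler_pdivrMr ?mul1r// exprn_gt0.
Qed.

Lemma Lm0 m : (0 < m)%N -> Lm m (fun=> 0) = 0.
Proof.
move=> m0; apply/eqP; rewrite eq_le Lm_ge0 andbT Lm_le//.
by rewrite (eq_Ex _ (g := fun=> 0 ^+ m)) ?Ex_cst// => x; rewrite normr0.
Qed.

Lemma Lm_minkowski_sum m (n : nat) (F : nat -> T -> R) (a : nat -> R) : (0 < m)%N ->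
  (forall p, (p < n)%N -> bm (F p) /\ Lm m (F p) <= a p) ->
  Lm m (fun x => \sum_(p < n) F p x) <= \sum_(p < n) a p.
Proof.
move=> m0; elim: n => [|n IH] h.
  by rewrite big_ord0 (_ : (fun x => _) = (fun=> 0)) ?Lm0//; apply/funext => x; rewrite big_ord0.
rewrite big_ord_recr /=.
rewrite (_ : (fun x => _) = (fun x => \sum_(p < n) F p x + F n x)); last first.
  by apply/funext => x; rewrite big_ord_recr.
apply: Lm_minkowski => //.
- by apply: bm_sum => -[p pn] _; case: (h p (ltnW pn)).
- by case: (h n (ltnSn n)).
- by apply: IH => p pn; apply: h; exact: ltnW.
- by case: (h n (ltnSn n)).
Qed.

Lemma LmM_le m f g a b : (0 < m)%N -> bm f -> bm g ->
  Lm (2 * m) f <= a -> Lm (2 * m) g <= b -> Lm m (fun x => f x * g x) <= a * b.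
Proof.
move=> m0 bf bg fa gb.
have a0 := le_trans (Lm_ge0 _ f) fa; have b0 := le_trans (Lm_ge0 _ g) gb.
have m20 : (0 < 2 * m)%N by rewrite muln_gt0.
rewrite (Lm_le _ m0 (mulr_ge0 a0 b0)).
rewrite (Lm_le f m20 a0) in fa; rewrite (Lm_le g m20 b0) in gb.
rewrite -(@ler_pXn2r _ 2)// ?nnegrE; [|by apply: Ex_ge0 => x; exact: exprn_ge0|by rewrite exprn_ge0// mulr_ge0].
have -> : \int[mu]_x (`|f x * g x| ^+ m) = \int[mu]_x (`|f x| ^+ m * `|g x| ^+ m).
  by apply: eq_Ex => x; rewrite normrM exprMn.
apply: le_trans (Ex_cauchy_schwarz _ _) _; rewrite ?bmX//; try by apply: bmX; exact: bm_norm.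
rewrite -exprM exprMn ![(m * 2)%N]mulnC ler_pM//; try by apply: Ex_ge0 => x; exact: sqr_ge0.
- by rewrite (eq_Ex _ (g := fun x => `|f x| ^+ (2 * m)))// => x; rewrite -exprM mulnC.
- by rewrite (eq_Ex _ (g := fun x => `|g x| ^+ (2 * m)))// => x; rewrite -exprM mulnC.
Qed.

End moment_inequalities.

(** * Moments of bounded martingale differences *)

Section bconst.
Context {R : realType}.

Lemma bconst_ge0 m : 0 <= bconst R m.
Proof. by rewrite /bconst; case: ifP => _; exact: powR_ge0. Qed.

Lemma bconst_even k : (0 < k)%N -> bconst R k.*2 ^+ k.*2 = gauss_moment k.
Proof.
by move=> k0; rewrite /bconst odd_double doubleK powR_invnK ?double_gt0.
Qed.

(** The odd constants are geometric means of the neighbouring even ones, which explains the square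
    root in their definition: an odd moment is bounded by Cauchy-Schwarz from
    [|S| ^+ (2k+1) = |S| ^+ k * |S| ^+ (k+1)]. *)
Lemma bconst_odd k :
  (bconst R k.*2.+1 ^+ k.*2.+1) ^+ 2 = gauss_moment k * gauss_moment k.+1.
Proof.
have k2 : 0 < k%:R + 2^-1 :> R by rewrite ltr_wpDl// ltr0n.
have p2 : 0 < 2 `^ (- (k%:R + 2^-1)) :> R by rewrite powR_gt0.
rewrite /bconst /= odd_double /= uphalf_double powR_invnK//.
rewrite exprMn exprMn exprVn sqr_sqrtr ?(ltW k2)//.
have -> : (2 `^ (- (k%:R + 2^-1))) ^+ 2 = 2 ^- k.*2.+1 :> R.
  rewrite -powR_mulrn ?powR_ge0// -powRrM -powR_invn//; congr (_ `^ _).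
  by rewrite mulNr mulrDl mulVf// -[in RHS]addn1 -muln2 natrD natrM.
have fn0 j : j`!%:R != 0 :> R by rewrite pnatr_eq0 -lt0n fact_gt0.
have gE j : gauss_moment j = j.*2`!%:R / (j`!%:R * 2 ^+ j) :> R.
  by rewrite -gauss_momentE mulfK// mulf_neq0 ?fn0 ?expf_neq0 ?pnatr_eq0.
have -> : (k.*2.+1 ^_ k.+1)%:R = k.*2.+1`!%:R / k`!%:R :> R.
  have kk : (k.+1 <= k.*2.+1)%N by rewrite ltnS -addnn leq_addr.
  rewrite -(ffact_fact kk) natrM (_ : _ - _ = k)%N ?mulfK//.
  by rewrite subSS -addnn addnK.
rewrite !gE doubleS !factS !natrM -addnn.
have e1 : (k + k).+1%:R = k%:R + k%:R + 1 :> R by rewrite -natr1 natrD.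
have e2 : (k + k).+2%:R = k%:R + k%:R + 1 + 1 :> R by rewrite -natr1 e1.
rewrite e1 e2 -natr1 !exprS exprD.
have k1 : k%:R + 1 != 0 :> R by rewrite natr1 pnatr_eq0.
have k22 : 2 * k%:R + 1 != 0 :> R by rewrite -natrM natr1 pnatr_eq0.
have k2n : 2 ^+ k != 0 :> R by rewrite expf_neq0 ?pnatr_eq0.
by field; rewrite k2n fn0 addrC k1 mulrC k22.
Qed.

Lemma bconst2 : bconst R 2 = 1.
Proof.
have : bconst R 2 ^+ 2 = 1 ^+ 2.
  rewrite (@bconst_even 1)// /gauss_moment /= ffactn1 expr1 expr1n.
  by rewrite divff.
move/eqP; rewrite eqrXn2 ?bconst_ge0//.
by move/eqP.
Qed.

End bconst.

Section martingale_moments.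
Context {R : realType} {d} {T : measurableType d}.
Variable mu : {measure set T -> \bar R}.
Hypothesis mu1 : mu [set: T] = 1%E.
Variables (Y : nat -> T -> R) (c : R) (N : nat).
Let S k x := \sum_(i < k) Y i x.
Hypothesis c0 : 0 <= c.
Hypothesis Ybm : forall k, (k < N)%N -> bm (Y k).
Hypothesis Yc : forall k x, (k < N)%N -> `|Y k x| <= c.
Hypothesis Yorth : forall k a n, (k < N)%N ->
  \int[mu]_x ((S k x + a) ^+ n * Y k x) = 0.

Let bmS k : (k <= N)%N -> bm (S k).
Proof.
move=> kN; apply: bm_sum => -[i ik] _; apply: Ybm; exact: leq_trans ik kN.
Qed.

(** Induction on the number of increments, for all moments at once. In the chord bound for
    [S k + Y k] the part linear in [Y k] integrates to 0 by [Yorth] with [a = c] and [a = - c]; the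
    even part is dominated term by term through [bin_gauss_moment]. *)
Lemma martingale_moment_even m :
  \int[mu]_x (S N x ^+ m.*2) <= gauss_moment m * (N%:R * c ^+ 2) ^+ m.
Proof.
(* The chord has slope proportional to [c^-1], so the degenerate case is separate. *)
have [c00|cn0] := eqVneq c 0.
  rewrite (eq_Ex _ (g := fun=> 0 ^+ m.*2)); last first.
    move=> x; congr (_ ^+ _); apply: big1 => -[i iN] _.
    by apply/eqP; rewrite -normr_le0 -c00; exact: Yc.
  rewrite Ex_cst// c00 (expr0n _ 2) mulr0; case: m => [|m]; last by rewrite doubleS !expr0n mulr0.
  by rewrite !expr0 mulr1 /gauss_moment ffactn0 expr0 mul1r invr1.
have cp : 0 < c by rewrite lt_def cn0.
suff H k : (k <= N)%N -> forall m,
    \int[mu]_x (S k x ^+ m.*2) <= gauss_moment m * (k%:R * c ^+ 2) ^+ m.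
  exact: H.
elim: k => [|k IH] kN {}m.
  rewrite (eq_Ex _ (g := fun=> 0 ^+ m.*2)); last by move=> x; rewrite /S big_ord0.
  rewrite Ex_cst// mul0r; case: m => [|m]; last by rewrite doubleS !expr0n mulr0.
  by rewrite !expr0 mulr1 /gauss_moment ffactn0 expr0 mul1r invr1.
have bSk := bmS (ltnW kN); have bY := Ybm kN.
have bSa a n : bm (fun x => (S k x + a) ^+ n) by apply: bmX; apply: bmD => //; exact: bm_cst.
apply: le_trans (_ : \int[mu]_x (
   (\sum_(j < m.+1) ('C(m.*2, j.*2)%:R * c ^+ (m - j).*2 * S k x ^+ j.*2)) +
   (2^-1 * c^-1) * ((S k x + c) ^+ m.*2 * Y k x - (S k x - c) ^+ m.*2 * Y k x)) <= _).
{ apply: le_Ex => //.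
  - by apply: bmX; exact: bmS.
  - apply: bmD; first by apply: bm_sum => j _; apply: bmZ; exact: bmX.
    by apply: bmZ; apply: bmB; apply: bmM.
  - move=> x; rewrite /S big_ord_recr /= -/(S k x).
    apply: le_trans (exprn_even_le_chord (S k x) m cp (Yc x kN)) _.
    by rewrite exprn_even_part lerD2l -mulrBl mulrA. }
have bsum : bm (fun x => \sum_(j < m.+1) ('C(m.*2, j.*2)%:R * c ^+ (m - j).*2 * S k x ^+ j.*2)).
  by apply: bm_sum => j _; apply: bmZ; exact: bmX.
rewrite ExD//; last by apply: bmZ; apply: bmB; apply: bmM.
rewrite ExZ//; last by apply: bmB; apply: bmM.
rewrite ExB//; [|by apply: bmM..].
rewrite !Yorth// subrr mulr0 addr0 Ex_sum//; last first.
  by move=> j _; apply: bmZ; exact: bmX.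
have -> : k.+1%:R * c ^+ 2 = c ^+ 2 + k%:R * c ^+ 2 by rewrite -natr1; ring.
rewrite exprDn mulr_sumr; apply: ler_sum => -[j /= jm] _.
have jm' : (j <= m)%N by rewrite -ltnS.
rewrite ExZ//; last exact: bmX.
apply: le_trans (_ : 'C(m.*2, j.*2)%:R * c ^+ (m - j).*2 * (gauss_moment j * (k%:R * c ^+ 2) ^+ j) <= _).
  by rewrite ler_wpM2l ?IH ?(ltnW kN)// mulr_ge0// exprn_ge0.
have -> : c ^+ (m - j).*2 = (c ^+ 2) ^+ (m - j) by rewrite -mul2n exprM.
rewrite mulrACA -[X in _ <= _ * X]mulr_natl [X in _ <= X]mulrA [X in _ <= X * _]mulrC.
by rewrite ler_wpM2r ?bin_gauss_moment// mulr_ge0// exprn_ge0// mulr_ge0// exprn_ge0.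
Qed.

Lemma martingale_Lm m : (0 < m)%N ->
  Lm mu m (S N) <= bconst R m * (Num.sqrt N%:R * c).
Proof.
move=> m0; have bS := bmS (leqnn N).
have s0 : 0 <= Num.sqrt N%:R * c by rewrite mulr_ge0// sqrtr_ge0.
have sE : N%:R * c ^+ 2 = (Num.sqrt N%:R * c) ^+ 2 by rewrite exprMn sqr_sqrtr.
rewrite Lm_le// ?mulr_ge0 ?bconst_ge0//.
have normE k : \int[mu]_x (`|S N x| ^+ k.*2) = \int[mu]_x (S N x ^+ k.*2).
  by apply: eq_Ex => x; rewrite -mul2n !exprM real_normK// num_real.
rewrite -[m]odd_double_half in m0 *; set k := m./2 in m0 *.
case: (odd m) m0 => /=; last first.
  rewrite add0n double_gt0 => k0; rewrite normE.
  apply: le_trans (martingale_moment_even _) _.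
  by rewrite [leRHS]exprMn bconst_even// sE -exprM mul2n.
rewrite add1n => _.
have ge0 j : 0 <= \int[mu]_x (`|S N x| ^+ j) by apply: Ex_ge0 => x; exact: exprn_ge0.
rewrite -(@ler_pXn2r _ 2)// ?nnegrE ?exprn_ge0 ?mulr_ge0 ?bconst_ge0//.
rewrite exprMn [leRHS]exprMn bconst_odd.
apply: le_trans (_ : \int[mu]_x (S N x ^+ k.*2) * \int[mu]_x (S N x ^+ k.+1.*2) <= _).
  rewrite -!normE.
  have -> : \int[mu]_x (`|S N x| ^+ k.*2.+1) = \int[mu]_x (`|S N x| ^+ k * `|S N x| ^+ k.+1).
    by apply: eq_Ex => x; rewrite -exprD addnS addnn.
  apply: le_trans (Ex_cauchy_schwarz mu1 _ _) _; try by apply: bmX; exact: bm_norm.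
  by rewrite le_eqVlt; apply/orP; left; apply/eqP; congr (_ * _); apply: eq_Ex => x; rewrite -exprM muln2.
apply: le_trans (ler_pM _ _ (martingale_moment_even _) (martingale_moment_even _)) _.
- by rewrite -normE.
- by rewrite -normE.
- rewrite mulrACA ler_wpM2l ?mulr_ge0 ?(ltW (gauss_moment_gt0 _))//.
  by rewrite sE -exprD -exprM -exprM addnS addnn mulnC.
Qed.

End martingale_moments.

(** * Conditionally independent samples *)

Section mean_functional.
Context {R : realType} {d} {T : measurableType d}.
Implicit Types (f g : T -> R) (L : (T -> R) -> R).

(** Integration against a probability, kept as a functional on bounded measurable functions.
    [eta_flow] is given only in this form, and empirical measures and transition laws fit it too, so
    that no measure has to be constructed. *)
Definition mean_functional L :=
  [/\ forall f g, bm f -> bm g -> L (fun x => f x + g x) = L f + L g,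
      forall c f, bm f -> L (fun x => c * f x) = c * L f,
      forall f g, bm f -> bm g -> (forall x, f x <= g x) -> L f <= L g &
      L (fun=> 1) = 1].

Variable L : (T -> R) -> R.
Hypothesis meanL : mean_functional L.

Lemma meanD f g : bm f -> bm g -> L (fun x => f x + g x) = L f + L g.
Proof. by case: meanL => + _ _ _; apply. Qed.

Lemma meanZ c f : bm f -> L (fun x => c * f x) = c * L f.
Proof. by case: meanL => _ + _ _; apply. Qed.

Lemma le_mean f g : bm f -> bm g -> (forall x, f x <= g x) -> L f <= L g.
Proof. by case: meanL => _ _ + _; apply. Qed.

Lemma mean_cst c : L (fun=> c) = c.
Proof.
have -> : (fun=> c) = (fun x : T => c * 1) by apply/funext => x; rewrite mulr1.
rewrite meanZ; last exact: bm_cst.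
by case: meanL => _ _ _ ->; rewrite mulr1.
Qed.

Lemma meanB f g : bm f -> bm g -> L (fun x => f x - g x) = L f - L g.
Proof.
move=> bf bg; rewrite -mulN1r -meanZ// -meanD//; last exact: bmZ.
by congr L; apply/funext => x; rewrite mulN1r.
Qed.

Lemma mean_ge f c : bm f -> (forall x, c <= f x) -> c <= L f.
Proof. by move=> bf cf; rewrite -[leLHS]mean_cst le_mean//; exact: bm_cst. Qed.

Lemma mean_le f c : bm f -> (forall x, f x <= c) -> L f <= c.
Proof. by move=> bf cf; rewrite -[leRHS]mean_cst le_mean//; exact: bm_cst. Qed.

Lemma mean_norm_le f c : bm f -> (forall x, `|f x| <= c) -> `|L f| <= c.
Proof.
move=> bf fc; rewrite ler_norml mean_ge ?mean_le// => x.
- by move: (fc x); rewrite ler_norml => /andP[].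
- by move: (fc x); rewrite ler_norml => /andP[].
Qed.

End mean_functional.

Lemma mean_avg {R : realType} {d} {T : measurableType d} (N : nat)
    (L : 'I_N -> (T -> R) -> R) : (0 < N)%N ->
  (forall i, mean_functional (L i)) ->
  mean_functional (fun f => N%:R^-1 * \sum_(i < N) L i f).
Proof.
move=> N0 mL; split.
- move=> f g bf bg /=; rewrite -mulrDr -big_split /=; congr (_ * _).
  by apply: eq_bigr => i _; exact: meanD.
- move=> c f bf /=; rewrite [RHS]mulrCA; congr (_ * _); rewrite mulr_sumr.
  by apply: eq_bigr => i _; exact: meanZ.
- move=> f g bf bg fg /=; rewrite ler_wpM2l// ler_sum// => i _.
  exact: le_mean.
- rewrite /= (eq_bigr (fun=> 1)); first by rewrite sumr_const card_ord mulVf// pnatr_eq0 -lt0n.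
  by move=> i _; rewrite (mean_cst (mL i)).
Qed.

Lemma mean_Ex {R : realType} {d} {T : measurableType d}
    (mu : {measure set T -> \bar R}) : mu [set: T] = 1%E ->
  mean_functional (fun f => \int[mu]_x f x).
Proof.
by move=> mu1; split; [exact: ExD|exact: ExZ|exact: le_Ex|exact: Ex_cst].
Qed.

Lemma mean_dirac {R : realType} {d} {T : measurableType d} (x : T) :
  mean_functional (fun f : T -> R => f x).
Proof. by split=> // f g _ _; apply. Qed.

Lemma Lm_dominated {R : realType} {d} {T : measurableType d}
    (mu : {measure set T -> \bar R}) (mu1 : mu [set: T] = 1%E) m (f g : T -> R) c a :
  (0 < m)%N -> bm f -> bm g -> 0 <= c -> (forall x, `|f x| <= c * `|g x|) ->
  Lm mu m g <= a -> Lm mu m f <= c * a.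
Proof.
move=> m0 bf bg c0 fg ga; have a0 := le_trans (Lm_ge0 _ _ _) ga.
rewrite (Lm_le _ _ m0 (mulr_ge0 c0 a0)); rewrite (Lm_le _ _ m0 a0) in ga.
apply: le_trans (_ : \int[mu]_x (c ^+ m * `|g x| ^+ m) <= _).
{ apply: le_Ex => //.
  - by apply: bmX; exact: bm_norm.
  - by apply: bmZ; apply: bmX; exact: bm_norm.
  - by move=> x; rewrite -exprMn lerXn2r// nnegrE mulr_ge0. }
rewrite ExZ//; last by apply: bmX; exact: bm_norm.
by rewrite exprMn ler_wpM2l// exprn_ge0.
Qed.

Section conditionally_independent_sample.
Context {R : realType} {dO} {Omega : measurableType dO}.
Variable P : {measure set Omega -> \bar R}.
Hypothesis P1 : P [set: Omega] = 1%E.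
Context {d} {T : measurableType d}.
Variables (n : nat) (Z : 'I_n.+1 -> Omega -> T) (past : set (set Omega)).
Variable K : 'I_n.+1 -> Omega -> (T -> R) -> R.
Local Notation N := n.+1.
Hypothesis mZ : forall i, measurable_fun [set: Omega] (Z i).
Hypothesis pastI : setI_closed past.
Hypothesis pastT : past [set: Omega].
Hypothesis pastm : past `<=` measurable.
Hypothesis Kmean : forall i w, mean_functional (K i w).
Hypothesis Kbm : forall i f, bm f ->
  bm ((fun w => K i w f) : g_sigma_algebraType past -> R).
Hypothesis Kindep : forall A (B : 'I_N -> set T), past A ->
  (forall i, measurable (B i)) ->
  \int[P]_w (\1_A w * \prod_(i < N) \1_(B i) (Z i w)) =
  \int[P]_w (\1_A w * \prod_(i < N) K i w \1_(B i)).

(* The pi-system generating the past together with the first [k] particles. *)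
Definition history (k : nat) : set (set Omega) :=
  [set C | exists A (B : 'I_N -> set T), [/\ past A, forall i, measurable (B i),
     forall i : 'I_N, (k <= i)%N -> B i = setT &
     C = A `&` \bigcap_(i in [set: 'I_N]) (Z i @^-1` B i)]].

Let bI U : measurable U -> bm (\1_U : T -> R). Proof. exact: bm_indic. Qed.

Let bZ i (f : T -> R) : bm f -> bm (fun w => f (Z i w)).
Proof. exact: bm_comp. Qed.

Let bK i f : bm f -> bm (fun w => K i w f).
Proof. by move=> bf; exact: bm_sub pastm (Kbm i bf). Qed.

Lemma historyI k : setI_closed (history k).
Proof.
move=> _ _ [A [B [pA mB BT ->]]] [A' [B' [pA' mB' BT' ->]]].
exists (A `&` A'), (fun i => B i `&` B' i); split.
- exact: pastI.
- by move=> i; exact: measurableI.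
- by move=> i ki; rewrite BT// BT'// setIT.
- rewrite setIACA -bigcapI; congr (_ `&` _).
Qed.

Lemma past_history k : past `<=` history k.
Proof.
move=> A pA; exists A, (fun=> setT); split=> //.
by rewrite [X in _ `&` X](_ : _ = setT) ?setIT//; apply/seteqP; split.
Qed.

Lemma Z_history k (i : 'I_N) U : (i < k)%N -> measurable U ->
  history k (Z i @^-1` U).
Proof.
move=> ik mU; exists setT, (fun j => if j == i then U else setT); split=> //.
- by move=> j; case: ifP.
- by move=> j kj; case: eqP => // ji; move: kj; rewrite ji leqNgt ik.
- rewrite setTI; apply/seteqP; split => [w Uw j _ /=|w /(_ i I)/=].
    by case: eqP => // ->.
  by rewrite eqxx.
Qed.

Lemma history_measurable k : history k `<=` measurable.
Proof.
move=> _ [A [B [pA mB _ ->]]]; apply: measurableI; first exact: pastm.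
apply: fin_bigcap_measurable => // i _.
by rewrite -[X in measurable X]setTI; exact: mZ.
Qed.

Lemma bm_past_history k (f : Omega -> R) :
  bm (f : g_sigma_algebraType past -> R) -> bm (f : g_sigma_algebraType (history k) -> R).
Proof.
move=> [mf bf]; split=> // _ B mB; have := mf measurableT B mB.
apply: sub_smallest2r; last exact: past_history.
exact: smallest_sigma_algebra.
Qed.

Lemma bm_Z_history k (i : 'I_N) (f : T -> R) : (i < k)%N -> bm f ->
  bm ((fun w => f (Z i w)) : g_sigma_algebraType (history k) -> R).
Proof.
move=> ik bf; apply: bm_comp bf => _ B mB; rewrite setTI.
by apply: sub_sigma_algebra; exact: Z_history.
Qed.

Lemma indic_prod (A : set Omega) (B : 'I_N -> set T) w :
  \1_(A `&` \bigcap_(i in [set: 'I_N]) (Z i @^-1` B i)) w =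
  \1_A w * \prod_(i < N) \1_(B i) (Z i w) :> R.
Proof.
rewrite indicI /=; congr (_ * _); rewrite indicE.
case: (boolP (w \in _)) => [/set_mem wB|/negP wB].
  by rewrite big1// => i _; rewrite indicE mem_set//; exact: wB.
have [i Bi] : exists i, ~ B i (Z i w).
  by apply: contrapT => /forallNP h; apply: wB; apply/mem_set => i _; apply: contrapT; exact: h.
by rewrite (bigD1 i)//= indicE memNset// mul0r.
Qed.

(** Random weights are needed because [K k w \1_U], which [sample_orthogonal_indic] moves out of the
    product, is itself a function of the past. *)
Lemma Kindep_fun f (B : 'I_N -> set T) :
  bm (f : g_sigma_algebraType past -> R) -> (forall i, measurable (B i)) ->
  \int[P]_w (f w * \prod_(i < N) \1_(B i) (Z i w)) =
  \int[P]_w (f w * \prod_(i < N) K i w \1_(B i)).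
Proof.
move=> bf mB; have bf' := bm_sub pastm bf.
have b1 : bm (fun w => \prod_(i < N) \1_(B i) (Z i w) : R).
  by apply: bm_prod => i; apply: (bZ i); exact: bI.
have b2 : bm (fun w => \prod_(i < N) K i w \1_(B i)).
  by apply: bm_prod => i; apply: bK; exact: bI.
apply/eqP; rewrite -subr_eq0 -ExB//; [|exact: bmM..].
apply/eqP; under eq_Rintegral do rewrite -mulrBr.
apply: (Ex_orthogonal P1 (RR := past)) => //; first exact: bmB.
move=> A pA; have bA : bm (\1_A : Omega -> R) by apply: bm_indic; exact: pastm.
under eq_Rintegral do rewrite mulrBr.
by rewrite ExB//; [rewrite Kindep// subrr|exact: bmM..].
Qed.

Lemma sample_orthogonal_indic (k : 'I_N) U C : measurable U -> history k C ->
  \int[P]_w (\1_C w * (\1_U (Z k w) - K k w \1_U)) = 0.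
Proof.
move=> mU hC; have bC : bm (\1_C : Omega -> R).
  by apply: bm_indic; exact: history_measurable hC.
have bU : bm (fun w => \1_U (Z k w) : R) by apply: bZ; exact: bI.
have bKU : bm (fun w => K k w \1_U) by apply: bK; exact: bI.
under eq_Rintegral do rewrite mulrBr.
rewrite ExB//; [|exact: bmM..]; apply/eqP; rewrite subr_eq0; apply/eqP.
have [A [B [pA mB BT CE]]] := hC.
(* An event of [history k] leaves particle [k] free ([B k = setT]), so requiring in addition that
   [Z k] lie in [U] yields a rectangle again. *)
pose B' i := if i == k then U else B i.
have mB' i : measurable (B' i) by rewrite /B'; case: ifP.
transitivity (\int[P]_w (\1_A w * \prod_(i < N) \1_(B' i) (Z i w))).
  apply: eq_Ex => w; rewrite CE indic_prod -mulrA; congr (_ * _).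
  rewrite (bigD1 k)//= [in RHS](bigD1 k)//= BT// indicT mul1r mulrC.
  rewrite /B' eqxx; congr (_ * _); apply: eq_bigr => i /negbTE ik.
  by rewrite ik.
rewrite Kindep//.
transitivity (\int[P]_w ((\1_A w * K k w \1_U) * \prod_(i < N) \1_(B i) (Z i w))); last first.
  by apply: eq_Ex => w; rewrite CE indic_prod mulrAC.
rewrite Kindep_fun//; last first.
  by apply: bmM; [apply: bm_indic; exact: sub_sigma_algebra|exact/Kbm/bI].
apply: eq_Ex => w; rewrite -mulrA; congr (_ * _).
rewrite (bigD1 k)//= [in RHS](bigD1 k)//= BT// indicT (mean_cst (Kmean k w)) mul1r.
rewrite {1}/B' eqxx; congr (_ * _); apply: eq_bigr => i /negbTE ik.
by rewrite /B' ik.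
Qed.

Lemma sample_orthogonal (k : 'I_N) (h : Omega -> R) f :
  bm (h : g_sigma_algebraType (history k) -> R) -> bm f ->
  \int[P]_w (h w * (f (Z k w) - K k w f)) = 0.
Proof.
move=> bh; have bh' := bm_sub (@history_measurable k) bh.
have bW g : bm g -> bm (fun w => g (Z k w) - K k w g).
  by move=> bg; apply: bmB; [exact: bZ|exact: bK].
have bhW g : bm g -> bm (fun w => h w * (g (Z k w) - K k w g)).
  by move=> bg; apply: bmM => //; exact: bW.
move: f; apply: bm_ind.
- move=> U mU; apply: (Ex_orthogonal P1 (RR := history k)) => //.
  + exact: historyI.
  + exact/past_history/pastT.
  + exact: history_measurable.
  + by apply: bW; exact: bI.
  + by move=> C hC; exact: sample_orthogonal_indic.
- move=> f g bf bg f0 g0; rewrite -[RHS](addr0 0) -{1}f0 -{1}g0 -ExD//; [|exact: bhW..].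
  by apply: eq_Ex => w; rewrite (meanD (Kmean k w))//; ring.
- move=> c f bf f0; rewrite -[RHS](mulr0 c) -f0 -ExZ//; last exact: bhW.
  by apply: eq_Ex => w; rewrite (meanZ (Kmean k w))//; ring.
- move=> f bf hf; have [_ [C0 hC0]] := bh'; pose C := Num.max C0 1.
  have C1 : 0 < C by rewrite lt_max ltr01 orbT.
  have hC w : `|h w| <= C by rewrite le_max hC0.
  apply/eqP; rewrite -normr_le0; apply/ler_addgt0Pr => e e0; rewrite add0r.
  (* The factor 2 shares the error between [f (Z k w)] and its conditional mean. *)
  have eC : 0 < e / (2 * C) by rewrite divr_gt0// mulr_gt0.
  have [g [bg g0 fg]] := hf _ eC.
  rewrite -[X in `|X|]subr0 -{1}g0 -ExB//; [|exact: bhW..].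
  apply: le_trans (le_norm_Ex P1 _) _; first by apply: bmB; exact: bhW.
  apply: Ex_le => //; first by apply: bm_norm; apply: bmB; exact: bhW.
  move=> w.
  have -> : h w * (f (Z k w) - K k w f) - h w * (g (Z k w) - K k w g) =
            h w * ((f (Z k w) - g (Z k w)) - K k w (fun x => f x - g x)).
    by rewrite (meanB (Kmean k w))//; ring.
  rewrite normrM (_ : e = C * (e / (2 * C) + e / (2 * C))); last by field; rewrite gt_eqF.
  rewrite ler_pM// (le_trans (ler_normB _ _))// lerD//.
  by apply: (mean_norm_le (Kmean k w)) => //; exact: bmB.
Qed.

Section fluctuation.
Variables (f g : T -> R) (a b : Omega -> R) (c : R).
Hypotheses (bf : bm f) (bg : bm g).
Hypothesis ba : bm (a : g_sigma_algebraType past -> R).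
Hypothesis bb : bm (b : g_sigma_algebraType past -> R).
Hypothesis hc : forall w x, `|a w * f x + b w * g x| <= c.

(** Two functions with coefficients known from the past: linearising a ratio involves the
    fluctuations of its numerator and of its denominator together. *)
Let Y i w := a w * (f (Z i w) - K i w f) + b w * (g (Z i w) - K i w g).

Let bY i : bm (Y i).
Proof.
by apply: bmD; (apply: bmM; [exact: bm_sub pastm _|apply: bmB; [exact: bZ|exact: bK]]).
Qed.

Let Yc i w : `|Y i w| <= 2 * c.
Proof.
have bh : bm (fun x => a w * f x + b w * g x) by apply: bmD; exact: bmZ.
have -> : Y i w = (a w * f (Z i w) + b w * g (Z i w)) - K i w (fun x => a w * f x + b w * g x).
  by rewrite (meanD (Kmean i w)) ?(meanZ (Kmean i w))//; [rewrite /Y; ring|exact: bmZ..].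
rewrite mulr2n mulrDl mul1r (le_trans (ler_normB _ _))// lerD//.
exact: (mean_norm_le (Kmean i w)).
Qed.

Let Yorth (k : 'I_N) (h : Omega -> R) : bm (h : g_sigma_algebraType (history k) -> R) ->
  \int[P]_w (h w * Y k w) = 0.
Proof.
move=> bh.
have bha : bm ((fun w => h w * a w) : g_sigma_algebraType (history k) -> R).
  by apply: bmM => //; exact: bm_past_history.
have bhb : bm ((fun w => h w * b w) : g_sigma_algebraType (history k) -> R).
  by apply: bmM => //; exact: bm_past_history.
have e1 := sample_orthogonal bha bf; have e2 := sample_orthogonal bhb bg.
rewrite -[RHS](addr0 0) -{1}e1 -{1}e2 -ExD//.
- by apply: eq_Ex => w; rewrite /Y; ring.
- by apply: bmM; [exact: bm_sub (@history_measurable k) _|apply: bmB; [exact: bZ|exact: bK]].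
- by apply: bmM; [exact: bm_sub (@history_measurable k) _|apply: bmB; [exact: bZ|exact: bK]].
Qed.

Lemma fluctuation_bm : bm (fun w => \sum_(i < N) Y i w).
Proof. by apply: bm_sum => i _; exact: bY. Qed.

Lemma fluctuation_mean : \int[P]_w (\sum_(i < N) Y i w) = 0.
Proof.
rewrite Ex_sum// big1// => i _; rewrite -(Yorth (k := i) (bm_cst 1)).
by apply: eq_Ex => w; rewrite mul1r.
Qed.

Lemma fluctuation_Lm m : (0 < m)%N ->
  Lm P m (fun w => \sum_(i < N) Y i w) <= bconst R m * (Num.sqrt N%:R * (2 * c)).
Proof.
(* The moment bounds index increments by [nat]; [inord] is the identity below [N]. *)
move=> m0; pose Y' k := Y (inord k).
have -> : (fun w => \sum_(i < N) Y i w) = (fun w => \sum_(i < N) Y' i w).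
  by apply/funext => w; apply: eq_bigr => i _; rewrite /Y' inord_val.
apply: martingale_Lm => //.
- by apply: le_trans (Yc ord0 point).
- by move=> k _; exact: bY.
- by move=> k w _; exact: Yc.
- move=> k e l kN; have kE : nat_of_ord (inord k : 'I_N) = k by rewrite inordK.
  apply: (Yorth (k := inord k)); rewrite kE; apply: bmX; apply: bmD; last exact: bm_cst.
  apply: bm_sum => i _.
  have ik : ((inord i : 'I_N) < k)%N by rewrite inordK// (ltn_trans (ltn_ord i)).
  by apply: bmD; (apply: bmM; [exact: bm_past_history|apply: bmB;
     [exact: bm_Z_history|apply: bm_past_history; exact: Kbm]]).
Qed.

End fluctuation.

(** * Second-order expansion of a ratio of empirical means *)

Section ratio.
Variables (g u : T -> R) (del q be : R).
Hypotheses (bg : bm g) (bu : bm u).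
Hypothesis del0 : 0 < del.
Hypothesis del_g : forall x, del <= g x.
Hypothesis g_q : forall x y, g x <= q * g y.
Hypothesis u_be : forall x y, `|u x - u y| <= be.
Let F x := g x * u x.
Let mu w (f : T -> R) := N%:R^-1 * \sum_(i < N) f (Z i w).
Let nu w (f : T -> R) := N%:R^-1 * \sum_(i < N) K i w f.

(* With [B = (mu - nu)(g) / nu(g)], the difference of ratios is [A / (1 + B)],
   split as [A - A B / (1 + B)]: the first term is centred and the second one is
   quadratic in the fluctuations. *)
Lemma ratio_error_decomposition : exists A D : Omega -> R,
  [/\ bm A /\ bm D,
      forall w, mu w F / mu w g - nu w F / nu w g = A w - D w,
      \int[P]_w A w = 0,
      forall m, (0 < m)%N ->
        Lm P m A <= bconst R m * ((Num.sqrt N%:R)^-1 * (2 * (q * be))) &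
      forall m, (0 < m)%N ->
        Lm P m D <= bconst R (2 * m) ^+ 2 * (N%:R^-1 * (4 * (q ^+ 3 * be)))].
Proof.
have bF : bm F by exact: bmM.
have N0 : 0 < N%:R :> R by rewrite ltr0n.
have mumean w : mean_functional (mu w) by apply: mean_avg => // i; exact: mean_dirac.
have numean w : mean_functional (nu w) by apply: mean_avg => // i; exact: Kmean.
have mug w : del <= mu w g by exact: (mean_ge (mumean w)).
have nug w : del <= nu w g by exact: (mean_ge (numean w)).
have mug0 w := lt_le_trans del0 (mug w); have nug0 w := lt_le_trans del0 (nug w).
have g0 x := lt_le_trans del0 (del_g x).
have q0 : 0 < q.
  have /(lt_le_trans (g0 point)) := g_q point point.
  by rewrite pmulr_lgt0.
have be0 : 0 <= be by apply: le_trans (u_be point point).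
have bnu f : bm f -> bm ((fun w => nu w f) : g_sigma_algebraType past -> R).
  by move=> bf; apply: bmZ; apply: bm_sum => i _; exact: Kbm.
have bmu f : bm f -> bm (fun w => mu w f).
  by move=> bf; apply: bmZ; apply: bm_sum => i _; exact: bZ.
have bnu' f : bm f -> bm (fun w => nu w f) by move=> bf; exact: bm_sub pastm (bnu _ bf).
have bnuV : bm ((fun w => (nu w g)^-1) : g_sigma_algebraType past -> R).
  by apply: (@bmV _ _ (g_sigma_algebraType past) _ del) => //; exact: bnu.
(* [al] and [ga] are the partial derivatives of [x / y] at [(nu w F, nu w g)], so that [A] below is
   the first-order Taylor term of the ratio. *)
pose al w := (nu w g)^-1.
pose ga w := - (nu w F * ((nu w g)^-1 * (nu w g)^-1)).
have bga : bm (ga : g_sigma_algebraType past -> R).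
  by apply: bmN; apply: bmM; [exact: bnu|exact: bmM].
pose SA w := \sum_(i < N) (al w * (F (Z i w) - K i w F) + ga w * (g (Z i w) - K i w g)).
pose SB w := \sum_(i < N) (0 * (F (Z i w) - K i w F) + al w * (g (Z i w) - K i w g)).
have mnuE w f : mu w f - nu w f = N%:R^-1 * \sum_(i < N) (f (Z i w) - K i w f).
  by rewrite -mulrBr -sumrB.
have AE w : N%:R^-1 * SA w = al w * (mu w F - nu w F) + ga w * (mu w g - nu w g).
  rewrite !mnuE mulrCA [ga w * _]mulrCA -mulrDr; congr (_ * _).
  by rewrite !mulr_sumr -big_split.
have BE w : N%:R^-1 * SB w = al w * (mu w g - nu w g).
  rewrite mnuE [RHS]mulrCA; congr (_ * _); rewrite mulr_sumr; apply: eq_bigr => i _.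
  by rewrite mul0r add0r.
have gnu w x : g x / nu w g <= q.
  rewrite ler_pdivrMr// mulrC -ler_pdivrMr// mulrC.
  apply: (mean_ge (numean w)) => // y; by rewrite ler_pdivrMl.
have hA w x : `|al w * F x + ga w * g x| <= q * be.
  have -> : al w * F x + ga w * g x = (g x / nu w g) * (u x - nu w F / nu w g).
    by rewrite /al /ga /F; field; rewrite gt_eqF.
  rewrite normrM ler_pM//; first by rewrite ger0_norm// divr_ge0// ltW.
  (* [nu w F / nu w g] is a [g]-weighted mean of [u], hence within [be] of each value [u x]. *)
  have -> : u x - nu w F / nu w g = nu w (fun y => g y * (u x - u y)) / nu w g.
    have -> : nu w (fun y => g y * (u x - u y)) = u x * nu w g - nu w F.
      rewrite -(meanZ (numean w))// -(meanB (numean w))//; last exact: bmZ.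
      by congr (nu w _); apply/funext => y; rewrite /F; ring.
    by field; rewrite gt_eqF.
  rewrite normrM [`|_^-1|]ger0_norm ?invr_ge0 ?(ltW (nug0 w))// ler_pdivrMr//.
  have bgu : bm (fun y => g y * (u x - u y)) by apply: bmM => //; apply: bmB => //; exact: bm_cst.
  rewrite -(meanZ (numean w))// ler_norml; apply/andP; split.
    rewrite lerNl -mulN1r -(meanZ (numean w))//.
    apply: (le_mean (numean w)); [exact: bmZ..|move=> y].
    rewrite mulN1r -mulrN mulrC ler_wpM2r ?(ltW (g0 _))//.
    by apply: le_trans (u_be x y); rewrite -normrN ler_norm.
  apply: (le_mean (numean w)) => // [|y]; first exact: bmZ.
  rewrite mulrC ler_wpM2r ?(ltW (g0 _))//.
  by apply: le_trans (u_be x y); rewrite ler_norm.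
have hB w x : `|0 * F x + al w * g x| <= q.
  by rewrite mul0r add0r mulrC /al ger0_norm ?gnu// divr_ge0 ?ltW.
have bSA : bm SA by exact: fluctuation_bm.
have bSB : bm SB by apply: fluctuation_bm => //; exact: bm_cst.
pose A w := N%:R^-1 * SA w; pose B w := N%:R^-1 * SB w.
have bA : bm A by exact: bmZ. have bB : bm B by exact: bmZ.
pose D w := (A w * B w) * (nu w g / mu w g).
have bD : bm D.
  by apply: bmM; [exact: bmM|apply: bmM; [exact: bnu'|by apply: (@bmV _ _ _ _ del) => //; exact: bmu]].
have sN : Num.sqrt N%:R != 0 :> R by rewrite gt_eqF// sqrtr_gt0.
have sNV : N%:R^-1 * Num.sqrt N%:R = (Num.sqrt N%:R)^-1 :> R.
  by rewrite -{1}(sqr_sqrtr (ltW N0)); field.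
have LA m : (0 < m)%N -> Lm P m A <= bconst R m * ((Num.sqrt N%:R)^-1 * (2 * (q * be))).
  move=> m0; rewrite -sNV -mulrA mulrCA.
  apply: (Lm_dominated P1 m0 bA bSA) => //.
    by move=> w; rewrite normrM ger0_norm// invr_ge0 ltW.
  exact: (fluctuation_Lm bF bg bnuV bga hA).
have LB m : (0 < m)%N -> Lm P m B <= bconst R m * ((Num.sqrt N%:R)^-1 * (2 * q)).
  move=> m0; rewrite -sNV -mulrA mulrCA.
  apply: (Lm_dominated P1 m0 bB bSB) => //.
    by move=> w; rewrite normrM ger0_norm// invr_ge0 ltW.
  exact: (fluctuation_Lm bF bg (bm_cst 0) bnuV hB).
exists A, D; split=> //.
- move=> w; rewrite /D /A /B AE BE /al /ga; field.
  by rewrite !gt_eqF.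
- by rewrite /A ExZ// fluctuation_mean// mulr0.
- move=> m m0; have m20 : (0 < 2 * m)%N by rewrite muln_gt0.
  (* The leading [q] bounds [nu w g / mu w g]; the other two factors are the bounds of [A] and [B]
     at exponent [2 * m]. *)
  rewrite (_ : _ * _ = q * ((bconst R (2 * m) * ((Num.sqrt N%:R)^-1 * (2 * (q * be)))) *
      (bconst R (2 * m) * ((Num.sqrt N%:R)^-1 * (2 * q))))); last first.
    have -> : N%:R^-1 = (Num.sqrt N%:R)^-1 * (Num.sqrt N%:R)^-1 :> R by rewrite -invfM -expr2 sqr_sqrtr// ltW.
    by ring.
  apply: (Lm_dominated P1 m0 bD (bmM bA bB)); first exact: ltW.
    move=> w; rewrite /D normrM mulrC ler_wpM2r// ger0_norm; last by rewrite divr_ge0 ?ltW.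
    rewrite ler_pdivrMr//.
    apply: (mean_le (numean w)) => // x.
    rewrite -ler_pdivrMl//; apply: (mean_ge (mumean w)) => // y.
    by rewrite ler_pdivrMl.
  by apply: LmM_le => //; [exact: LA|exact: LB].
Qed.

End ratio.
End conditionally_independent_sample.

(** * The particle system *)

Section feynman_kac.
Context {R : realType} {d : nat -> measure_display}
  {S : forall n, measurableType (d n)}.
Variables (eta0 : probability (S 0) R) (M : forall n, R.-pker (S n) ~> (S n.+1))
  (G : forall n, S n -> R).
Arguments G : clear implicits.
Hypothesis G_meas : forall n, measurable_fun [set: S n] (G n).
Hypothesis G_01 : forall n x, 0 < G n x < 1.
Arguments G_01 : clear implicits.
Hypothesis q_fin : forall n, exists q : R, forall x y, G n x / G n y <= q.

Lemma kernel_mass1 n x : M n x [set: S n.+1] = 1%E.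
Proof. exact: prob_kernel. Qed.
Arguments kernel_mass1 : clear implicits.

Lemma mean_Mop n x : mean_functional (fun f => Mop M n f x).
Proof. exact: (mean_Ex (kernel_mass1 n x)). Qed.
Arguments mean_Mop : clear implicits.

Lemma Mop_indic n x U : measurable U -> Mop M n \1_U x = fine (M n x U).
Proof. exact: Ex_indic. Qed.

Lemma bm_Mop n f : bm f -> bm (Mop M n f).
Proof.
move=> bf; have [mf [C fC]] := bf; split; last first.
  by exists C => x; exact: (mean_norm_le (mean_Mop n x)).
(* Measurability of kernel integrals is used for nonnegative integrands, hence the shift by [C]. *)
have bfC : bm (fun x => f x + C) by apply: bmD => //; exact: bm_cst.
have -> : Mop M n f = (fun x => fine (\int[M n x]_y (f y + C)%:E) - C).
  apply/funext => x; have := meanD (mean_Mop n x) bf (bm_cst C).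
  by rewrite (mean_cst (mean_Mop n x)) /Mop => ->; rewrite addrK.
apply: measurable_funB => //; apply: measurableT_comp => //.
apply: (measurable_fun_integral_kernel (l := M n)) => //.
- by move=> U mU; exact: measurable_kernel.
- by move=> z; rewrite lee_fin -lerBlDr sub0r; have := fC z; rewrite ler_norml => /andP[].
- by apply/measurable_EFinP; case: bfC.
Qed.

Lemma bm_G n : bm (G n).
Proof.
split; first exact: G_meas.
by exists 1 => x; have /andP[h1 h2] := G_01 n x; rewrite ger0_norm ltW.
Qed.

Lemma G_gt0 n x : 0 < G n x. Proof. by case/andP: (G_01 n x). Qed.

(** Pointwise positivity becomes uniform through [q_fin], with [point] as reference. All the
    denominators below rest on this. *)
Lemma G_lower n : exists2 e, 0 < e & forall x, e <= G n x.
Proof.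
have [q hq] := q_fin n.
have q0 : 0 < q by apply: lt_le_trans (hq point point); rewrite divr_gt0 ?G_gt0.
exists (G n point / q); first by rewrite divr_gt0 ?G_gt0.
by move=> x; rewrite ler_pdivrMr// mulrC -ler_pdivrMr ?G_gt0.
Qed.

Lemma bm_Qop n f : bm f -> bm (Qop M G n f).
Proof. by move=> bf; apply: bmM; [exact: bm_G|exact: bm_Mop]. Qed.

Lemma QopD n f g : bm f -> bm g ->
  Qop M G n (fun x => f x + g x) = (fun x => Qop M G n f x + Qop M G n g x).
Proof.
by move=> bf bg; apply/funext => x; rewrite /Qop (meanD (mean_Mop n x))// mulrDr.
Qed.

Lemma QopZ n c f : bm f -> Qop M G n (fun x => c * f x) = (fun x => c * Qop M G n f x).
Proof.
by move=> bf; apply/funext => x; rewrite /Qop (meanZ (mean_Mop n x))// mulrCA.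
Qed.

Lemma Qop1 n : Qop M G n (fun=> 1) = G n.
Proof. by apply/funext => x; rewrite /Qop (mean_cst (mean_Mop n x)) mulr1. Qed.

Lemma le_Qop n f g : bm f -> bm g -> (forall x, f x <= g x) ->
  forall x, Qop M G n f x <= Qop M G n g x.
Proof.
move=> bf bg fg x; rewrite /Qop ler_wpM2l ?(ltW (G_gt0 x))//.
exact: (le_mean (mean_Mop n x)).
Qed.

Lemma bm_Qk p k f : bm f -> bm (Qk M G p k f).
Proof. by elim: k f => [|k IH] f bf //=; apply: IH; exact: bm_Qop. Qed.

Lemma QkZ p k c f : bm f -> Qk M G p k (fun x => c * f x) = (fun x => c * Qk M G p k f x).
Proof.
by elim: k f => [|k IH] f bf //=; rewrite QopZ// IH//; exact: bm_Qop.
Qed.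

Lemma le_Qk p k f g : bm f -> bm g -> (forall x, f x <= g x) ->
  forall x, Qk M G p k f x <= Qk M G p k g x.
Proof.
elim: k f g => [|k IH] f g bf bg fg x //=.
by apply: IH; [exact: bm_Qop..|exact: le_Qop].
Qed.

Lemma Qk1_lower p k : exists2 e, 0 < e & forall x, e <= Qk M G p k (fun=> 1) x.
Proof.
elim: k => [|k [e e0 IH]]; first by exists 1.
have [c c0 cG] := G_lower (k + p).
exists (c * e); first exact: mulr_gt0.
move=> x /=; rewrite Qop1; apply: le_trans (_ : c * Qk M G p k (fun=> 1) x <= _).
  by rewrite ler_wpM2l// ltW.
have /(congr1 (@^~ x)) <- := QkZ (p := p) (k := k) c (bm_cst 1).
apply: le_Qk; [by apply: bmZ; exact: bm_cst|exact: bm_G|].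
by move=> y; rewrite mulr1.
Qed.

Lemma Qk1_gt0 p k x : 0 < Qk M G p k (fun=> 1) x.
Proof. by have [e e0 /(_ x)] := Qk1_lower p k; exact: lt_le_trans. Qed.
Arguments Qk1_gt0 : clear implicits.

(** A real [sup] majorises its set only when the set is bounded above; the bound [C / e] comes from
    the uniform lower bound [e] on [Q_{p,n}(1)]. *)
Lemma le_qk p k x y :
  Qk M G p k (fun=> 1) x <= qk M G p k * Qk M G p k (fun=> 1) y.
Proof.
rewrite -ler_pdivrMr ?Qk1_gt0//; apply: ub_le_sup; last by exists x => //; exists y.
have [e e0 he] := Qk1_lower p k; have [_ [C hC]] := bm_Qk (p := p) (k := k) (bm_cst 1).
exists (C / e) => _ [a _ [b _ <-]].
have C0 : 0 <= C by apply: le_trans (hC a).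
apply: ler_pM; rewrite ?invr_ge0 ?(ltW (Qk1_gt0 _ _ _))//.
  by rewrite (le_trans (ler_norm _)).
by rewrite lef_pV2// posrE// Qk1_gt0.
Qed.

Lemma Osc1_bm n (f : S n -> R) : Osc1 f -> bm f.
Proof.
move=> [mf of1]; split=> //; exists (1 + `|f point|) => x.
by rewrite -{1}(subrK (f point) (f x)) (le_trans (ler_normD _ _))// lerD.
Qed.

(** A crude a priori bound, through comparison with [f point], making the suprema in [osc] and
    [betak] those of bounded sets. *)
Lemma Osc1_Pk p k f : Osc1 f -> forall x y, `|Pk M G p k f x - Pk M G p k f y| <= 2.
Proof.
move=> f1; have bf := Osc1_bm f1; have [_ of1] := f1.
suff H x : `|Pk M G p k f x - f point| <= 1.
  move=> x y.
  have -> : Pk M G p k f x - Pk M G p k f y =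
      (Pk M G p k f x - f point) - (Pk M G p k f y - f point) by ring.
  by rewrite (le_trans (ler_normB _ _))// (_ : 2 = 1 + 1)// lerD.
have Q0 := Qk1_gt0 p k x.
have up := le_Qk (p := p) (k := k) (f := f) (g := fun z => (f point + 1) * 1) bf (bm_cst _) _ x.
have lo := le_Qk (p := p) (k := k) (f := fun z => (f point - 1) * 1) (g := f) (bm_cst _) bf _ x.
rewrite !QkZ in up lo; [|exact: bm_cst..].
rewrite ler_norml lerBrDr lerBlDr /Pk ler_pdivlMr// ler_pdivrMr//.
have of2 z : f point - 1 <= f z <= f point + 1.
  by rewrite -ler_distl.
by rewrite [-1 + _]addrC [1 + _]addrC up ?lo// => z; rewrite mulr1; case/andP: (of2 z).
Qed.

Lemma Pk_le_betak p k f x y : Osc1 f ->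
  `|Pk M G p k f x - Pk M G p k f y| <= betak M G p k.
Proof.
move=> f1; apply: le_trans (_ : osc (Pk M G p k f) <= _).
  apply: ub_le_sup; last by exists x => //; exists y.
  by exists 2 => _ [a _ [b _ <-]]; exact: Osc1_Pk.
apply: ub_le_sup; last by exists f.
exists 2 => _ [g g1 <-]; apply: ge_sup.
  by exists `|Pk M G p k g point - Pk M G p k g point|; exists point => //; exists point.
by move=> _ [a _ [b _ <-]]; exact: Osc1_Pk.
Qed.

(** The update of [L] into [Psi_n(L) M_{n+1}]; it serves for the limiting flow and for the empirical
    measures alike. *)
Lemma mean_ratio n (L : (S n -> R) -> R) : mean_functional L ->
  mean_functional (fun f => L (Qop M G n f) / L (G n)).
Proof.
move=> mL; have [e e0 he] := G_lower n.
have LG : 0 < L (G n) by apply: lt_le_trans e0 (mean_ge mL (bm_G n) he).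
split.
- by move=> f g bf bg; rewrite QopD// (meanD mL) ?mulrDl//; exact: bm_Qop.
- by move=> c f bf; rewrite QopZ// (meanZ mL) ?mulrA//; exact: bm_Qop.
- move=> f g bf bg fg; rewrite ler_pM2r ?invr_gt0//.
  by apply: (le_mean mL); [exact: bm_Qop..|exact: le_Qop].
- by rewrite Qop1 divff// gt_eqF.
Qed.

Lemma mean_eta_flow n : mean_functional (eta_flow M G eta0 n).
Proof.
elim: n => [|n IH]; last exact: mean_ratio.
by apply: mean_Ex; exact: probability_setT.
Qed.

Lemma mean_emp N n (xs : 'I_N.+1 -> S n) : mean_functional (emp (R := R) xs).
Proof. by apply: mean_avg => // i; exact: mean_dirac. Qed.

(** * The backward semigroup, with transport along index equalities *)

Section backward.

(* [S (n - p + p)] and [S n] are only propositionally equal. *)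
Definition castS m n (e : m = n) (f : S m -> R) : S n -> R :=
  eq_rect m (fun i => S i -> R) f n e.

Lemma castS_id n (e : n = n) f : castS e f = f.
Proof. by rewrite (nat_irrelevance e erefl). Qed.

Lemma castS_trans m n l (e : m = n) (e' : n = l) (e'' : m = l) f :
  castS e' (castS e f) = castS e'' f.
Proof. by subst; rewrite !castS_id. Qed.

Lemma castS_Qop m n (e : m = n) (e' : m.+1 = n.+1) f :
  castS e (Qop M G m f) = Qop M G n (castS e' f).
Proof. by subst; rewrite !castS_id. Qed.

(** [Qk] is defined by peeling operators off at the terminal time, whereas the telescoping sum peels
    them off at the initial one. *)
Lemma Qk_first p k (e : (k.+1 + p)%N = (k + p.+1)%N) f :
  Qk M G p k.+1 f = Qop M G p (Qk M G p.+1 k (castS e f)).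
Proof.
elim: k e f => [|k IH] e f; first by rewrite (castS_id (n := p.+1) e).
have e' : (k.+1 + p)%N = (k + p.+1)%N by rewrite addnS.
transitivity (Qk M G p k.+1 (Qop M G (k.+1 + p) f)) => //.
by rewrite (IH e') (castS_Qop e' e).
Qed.

Variable n : nat.

(* [back n f p] is [Q_{p,n} f] for [p <= n], and the junk value [0] for [p > n]. *)
Definition back (f : S n -> R) p : S p -> R :=
  match n =P (n - p + p)%N with
  | ReflectT e => Qk M G p (n - p) (castS e f)
  | ReflectF _ => fun=> 0
  end.
Arguments back : clear implicits.

Lemma backE f p (e : n = (n - p + p)%N) :
  back f p = Qk M G p (n - p) (castS e f).
Proof.
by rewrite /back; case: eqP => // e'; rewrite (nat_irrelevance e' e).
Qed.

Lemma back_last f : back f n = f.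
Proof.
have e : n = (n - n + n)%N by rewrite subnn.
rewrite (backE f e); move: e; rewrite subnn => e; exact: castS_id.
Qed.

Lemma back_step f p : (p < n)%N -> back f p = Qop M G p (back f p.+1).
Proof.
move=> pn.
have e : n = (n - p + p)%N by rewrite subnK// ltnW.
have e' : n = (n - p.+1 + p.+1)%N by rewrite subnK.
rewrite (backE f e) (backE f e'); move: e e'.
rewrite subnS; case: (n - p)%N (subn_gt0 p n) => [|k _ e e']; first by rewrite pn.
have e'' : (k.+1 + p)%N = (k + p.+1)%N by rewrite addnS.
by rewrite (Qk_first e'') (castS_trans e e'' e').
Qed.

Lemma back1 p : (p <= n)%N -> back (fun=> 1) p = Qk M G p (n - p) (fun=> 1).
Proof.
move=> pn; have e : n = (n - p + p)%N by rewrite subnK.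
rewrite (backE _ e); congr (Qk _ _ _ _ _).
by case: _ / e.
Qed.

Lemma back_Osc1 f p : (p <= n)%N -> Osc1 f ->
  exists2 f', Osc1 f' & back f p = Qk M G p (n - p) f'.
Proof.
move=> pn f1; have e : n = (n - p + p)%N by rewrite subnK.
exists (castS e f); last exact: backE.
by case: _ / e.
Qed.

End backward.
Arguments back : clear implicits.

(** * Local errors, telescoping and the final estimates *)

Section particles.
Context {dO : measure_display} {Omega : measurableType dO}.
Variables (P : probability Omega R) (N' : nat).
Local Notation N := N'.+1.
Variable X : forall n, 'I_N -> Omega -> S n.
Arguments X : clear implicits.
Hypothesis X_meas : forall n i, measurable_fun [set: Omega] (X n i).
Arguments X_meas : clear implicits.
Hypothesis X_init : forall A : 'I_N -> set (S 0), (forall i, measurable (A i)) ->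
  P (\bigcap_(i in [set: 'I_N]) (X 0 i @^-1` A i)) = (\prod_(i < N) eta0 (A i))%E.
Hypothesis X_step : forall n (A : 'I_N -> set (S n)) (B : 'I_N -> set (S n.+1)),
  (forall i, measurable (A i)) -> (forall i, measurable (B i)) ->
  P (\bigcap_(i in [set: 'I_N]) (X n i @^-1` A i `&` X n.+1 i @^-1` B i))
  = (\int[P]_w (\prod_(i < N)
      (\1_(A i) (X n i w) * Kemp M G n (fun j => X n j w) (X n i w) (B i)))%:E)%E.

Let P1 : P [set: Omega] = 1%E. Proof. exact: probability_setT. Qed.

Local Notation eta_N n w := (emp (fun j => X n j w)).

(* A pi-system generating the sigma-algebra of the particles at time [n - 1]. *)
Definition past n : set (set Omega) :=
  if n is m.+1 then
    [set C | exists2 A : 'I_N -> set (S m), forall i, measurable (A i) &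
       C = \bigcap_(i in [set: 'I_N]) (X m i @^-1` A i)]
  else [set [set: Omega]].

(* [transition n i w] is the conditional law of the [i]-th particle at time [n]
   given the past, i.e. [K_{n, eta_{n-1}^N}(X_{n-1}^i, .)], acting on functions. *)
Definition transition n : 'I_N -> Omega -> (S n -> R) -> R :=
  match n with
  | 0 => fun _ _ f => \int[eta0]_x f x
  | m.+1 => fun i w f => G m (X m i w) * Mop M m f (X m i w) +
      (1 - G m (X m i w)) * (eta_N m w (Qop M G m f) / eta_N m w (G m))
  end.
Arguments transition : clear implicits.

(* The conditional mean [nu_n] of [eta_n^N] given the past. *)
Definition predicted n (w : Omega) : (S n -> R) -> R :=
  match n with
  | 0 => eta_flow M G eta0 0
  | m.+1 => fun f => eta_N m w (Qop M G m f) / eta_N m w (G m)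
  end.
Arguments predicted : clear implicits.

Lemma emp_G_gt0 n w : 0 < eta_N n w (G n).
Proof.
have [e e0 he] := G_lower n.
exact: lt_le_trans e0 (mean_ge (mean_emp (fun j => X n j w)) (bm_G n) he).
Qed.

(** With [e] the empirical measure, averaging the selection step gives [e(Q f) + (1 - e(G)) e(Q f) /
    e(G) = e(Q f) / e(G)]. *)
Lemma predictedE n w f : predicted n w f = N%:R^-1 * \sum_(i < N) transition n i w f.
Proof.
have Nn0 : N%:R != 0 :> R by rewrite pnatr_eq0.
case: n f => [|m] f /=.
  by rewrite sumr_const card_ord -[X in _ * X]mulr_natl mulrA mulVf// mul1r.
rewrite big_split -mulr_suml sumrB sumr_const card_ord /=.
have eG : \sum_(i < N) G m (X m i w) = N%:R * eta_N m w (G m).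
  by rewrite /emp mulrA divff// mul1r.
have eQ : \sum_(i < N) G m (X m i w) * Mop M m f (X m i w) = N%:R * eta_N m w (Qop M G m f).
  by rewrite /emp mulrA divff// mul1r.
rewrite eG eQ; move: (N%:R : R) Nn0 => r rn0; field.
by rewrite rn0 gt_eqF// emp_G_gt0.
Qed.

Lemma past_setI n : setI_closed (past n).
Proof.
case: n => [|m] /= A B; first by move=> -> ->; rewrite setIT.
move=> [A' mA ->] [B' mB ->]; exists (fun i => A' i `&` B' i).
  by move=> i; exact: measurableI.
by rewrite -bigcapI.
Qed.

Lemma past_setT n : past n [set: Omega].
Proof.
by case: n => [|m] //=; exists (fun=> setT) => //; apply/seteqP; split.
Qed.

Lemma past_measurable n : past n `<=` measurable.
Proof.
case: n => [_ -> //|m _ [A mA ->]].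
apply: fin_bigcap_measurable => // i _.
by rewrite -[X in measurable X]setTI; exact: X_meas.
Qed.

Lemma mean_transition n i w : mean_functional (transition n i w).
Proof.
case: n => [|m] /=; first by apply: mean_Ex; exact: probability_setT.
set x := X m i w; have mM := mean_Mop m x.
have mr := mean_ratio (mean_emp (fun j => X m j w)).
have g0 := ltW (G_gt0 x); have g1 : 0 <= 1 - G m x.
  by rewrite subr_ge0 ltW//; case/andP: (G_01 m x).
split.
- by move=> f g bf bg; rewrite (meanD mM)// (meanD mr)//; ring.
- by move=> c f bf; rewrite (meanZ mM)// (meanZ mr)//; ring.
- by move=> f g bf bg fg; rewrite lerD// ler_wpM2l//; [exact: (le_mean mM)|exact: (le_mean mr)].
- by rewrite (mean_cst mM) (mean_cst mr); ring.
Qed.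

Lemma bm_X_past m i (f : S m -> R) : bm f ->
  bm ((fun w => f (X m i w)) : g_sigma_algebraType (past m.+1) -> R).
Proof.
move=> bf; apply: bm_comp bf => _ U mU; rewrite setTI.
apply: sub_sigma_algebra; exists (fun j => if j == i then U else setT).
  by move=> j; case: ifP.
apply/seteqP; split => [w Uw j _ /=|w /(_ i I)/=].
  by case: eqP => // ->.
by rewrite eqxx.
Qed.

Lemma bm_transition n i f : bm f ->
  bm ((fun w => transition n i w f) : g_sigma_algebraType (past n) -> R).
Proof.
case: n f => [|m] f bf; first exact: bm_cst.
have bE h : bm h -> bm ((fun w => eta_N m w h) : g_sigma_algebraType (past m.+1) -> R).
  by move=> bh; apply: bmZ; apply: bm_sum => j _; exact: bm_X_past.
have [e e0 he] := G_lower m.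
apply: bmD.
  by apply: bmM; apply: bm_X_past; [exact: bm_G|exact: bm_Mop].
apply: bmM; first by apply: bmB; [exact: bm_cst|apply: bm_X_past; exact: bm_G].
apply: bmM; first by apply: bE; exact: bm_Qop.
apply: (@bmV _ _ (g_sigma_algebraType (past m.+1)) _ e) => //; last by apply: bE; exact: bm_G.
move=> w; exact: (mean_ge (mean_emp (fun j => X m j w)) (bm_G m) he).
Qed.

Lemma transition_indic m i w U : measurable U ->
  transition m.+1 i w \1_U = Kemp M G m (fun j => X m j w) (X m i w) U.
Proof.
move=> mU; rewrite /= /Kemp Mop_indic//; congr (_ + _ * (_ / _)).
by congr emp; apply/funext => y; rewrite /Qop Mop_indic.
Qed.

(** The conditional independence required of a sample. At time 0 the past is trivial and this is
    [X_init]; later a past event is a rectangle in the preceding particles and this is [X_step]. *)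
Lemma transition_indep n A (B : 'I_N -> set (S n)) : past n A ->
  (forall i, measurable (B i)) ->
  \int[P]_w (\1_A w * \prod_(i < N) \1_(B i) (X n i w)) =
  \int[P]_w (\1_A w * \prod_(i < N) transition n i w \1_(B i)).
Proof.
case: n A B => [|m] A B /=.
  move=> -> mB.
  transitivity (fine (P (\bigcap_(i in [set: 'I_N]) (X 0 i @^-1` B i)))).
    under eq_Rintegral do rewrite -indic_prod setTI.
    apply: Ex_indic; apply: fin_bigcap_measurable => // i _.
    by rewrite -[X in measurable X]setTI; exact: X_meas.
  rewrite X_init// (eq_Ex _ (g := fun=> \prod_(i < N) fine (eta0 (B i)))); last first.
    by move=> w; rewrite indicT mul1r; apply: eq_bigr => i _; rewrite Ex_indic.
  rewrite Ex_cst// (eq_bigr (fun i => (fine (eta0 (B i)))%:E)); last first.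
    by move=> i _; rewrite fineK// fin_num_measure.
  by rewrite prodEFin.
move=> [A' mA ->] mB.
transitivity (fine (P (\bigcap_(i in [set: 'I_N])
    (X m i @^-1` A' i `&` X m.+1 i @^-1` B i)))).
  rewrite -Ex_indic; last first.
    apply: fin_bigcap_measurable => // i _.
    by apply: measurableI; rewrite -[X in measurable X]setTI; exact: X_meas.
  by apply: eq_Ex => w; rewrite bigcapI indic_prod.
rewrite X_step//; apply: eq_Ex => w.
have := @indic_prod R _ _ _ (S m) _ (X m) setT A' w.
rewrite setTI indicT mul1r => ->; rewrite -big_split /=.
by apply: eq_bigr => i _; rewrite -transition_indic.
Qed.

(** The ratio expansion with [g = Q_{p,n}(1)] and [u = P_{p,n}(f)], for which
    [g * u = Q_{p,n}(f)]. *)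
Lemma local_error p k f : Osc1 f -> exists A D : Omega -> R,
  [/\ bm A /\ bm D,
      forall w, eta_N p w (Qk M G p k f) / eta_N p w (Qk M G p k (fun=> 1))
        - predicted p w (Qk M G p k f) / predicted p w (Qk M G p k (fun=> 1))
        = A w - D w,
      \int[P]_w A w = 0,
      forall m, (0 < m)%N -> Lm P m A <= bconst R m *
        ((Num.sqrt N%:R)^-1 * (2 * (qk M G p k * betak M G p k))) &
      forall m, (0 < m)%N -> Lm P m D <= bconst R (2 * m) ^+ 2 *
        (N%:R^-1 * (4 * (qk M G p k ^+ 3 * betak M G p k)))].
Proof.
move=> f1; have bf := Osc1_bm f1.
have [e e0 he] := Qk1_lower p k.
have b1 : bm (Qk M G p k (fun=> 1)) by apply: bm_Qk; exact: bm_cst.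
have bP : bm (Pk M G p k f).
  by apply: bmM; [exact: bm_Qk|apply: (@bmV _ _ _ _ e)].
have := @ratio_error_decomposition R _ _ P P1 _ _ N' (X p) (past p) (transition p)
  (X_meas p) (@past_setI p) (@past_setT p) (@past_measurable p) (mean_transition p)
  (@bm_transition p) (@transition_indep p) (Qk M G p k (fun=> 1)) (Pk M G p k f) e
  (qk M G p k) (betak M G p k) b1 bP e0 he (@le_qk p k)
  (fun x y => Pk_le_betak x y f1).
have gu x : Qk M G p k (fun=> 1) x * Pk M G p k f x = Qk M G p k f x.
  by rewrite /Pk mulrCA divff ?mulr1// gt_eqF// Qk1_gt0.
rewrite (funext gu : (fun x => _) = Qk M G p k f).
move=> [A [D [bAD AD EA LA LD]]]; exists A, D; split=> // w.
rewrite !predictedE -AD /emp; congr (_ * _ / _ - _).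
by apply: eq_bigr => i _; rewrite gu.
Qed.

Lemma predicted_step n p w f : (p < n)%N ->
  predicted p.+1 w (back n f p.+1) / predicted p.+1 w (back n (fun=> 1) p.+1) =
  eta_N p w (back n f p) / eta_N p w (back n (fun=> 1) p).
Proof.
move=> pn; rewrite /= -!back_step// -mulf_div divff ?mulr1//.
by rewrite invr_eq0 gt_eqF// emp_G_gt0.
Qed.

(** The normalising factors [eta_p(G_p)] cancel, so the ratio is constant along the flow; at [p = n]
    it equals [eta_n(f)], which identifies the initial term of the telescoping sum. *)
Lemma eta_flow_back n p f : (p <= n)%N ->
  eta_flow M G eta0 p (back n f p) / eta_flow M G eta0 p (back n (fun=> 1) p) =
  eta_flow M G eta0 0 (back n f 0) / eta_flow M G eta0 0 (back n (fun=> 1) 0).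
Proof.
elim: p => [//|p IH] pn; rewrite -IH ?(ltnW pn)// [in LHS]/= -!back_step//.
rewrite -mulf_div divff ?mulr1// invr_eq0 gt_eqF//.
have [e e0 he] := G_lower p.
exact: lt_le_trans e0 (mean_ge (mean_eta_flow p) (bm_G p) he).
Qed.

Lemma telescope n f w :
  eta_N n w f - eta_flow M G eta0 n f =
  \sum_(p < n.+1) (eta_N p w (back n f p) / eta_N p w (back n (fun=> 1) p)
     - predicted p w (back n f p) / predicted p w (back n (fun=> 1) p)).
Proof.
pose U p := eta_N p w (back n f p) / eta_N p w (back n (fun=> 1) p).
pose V p := predicted p w (back n f p) / predicted p w (back n (fun=> 1) p).
have VU p : (p < n)%N -> V p.+1 = U p by exact: predicted_step.
have H j : (j <= n)%N -> \sum_(p < j.+1) (U p - V p) = U j - V 0.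
  elim: j => [|j IH] jn; first by rewrite big_ord1.
  by rewrite big_ord_recr /= IH ?(ltnW jn)// VU// addrC addrA subrK.
rewrite [RHS](H n (leqnn n)) {1}/U !back_last (mean_cst (mean_emp (fun j => X n j w))) divr1.
congr (_ - _); rewrite -[RHS](eta_flow_back _ (leqnn n)) !back_last.
by rewrite (mean_cst (mean_eta_flow n)) divr1.
Qed.

Lemma error_decomposition n f : Osc1 f -> exists A D : nat -> Omega -> R,
  [/\ forall w, eta_N n w f - eta_flow M G eta0 n f = \sum_(p < n.+1) (A p w - D p w),
      forall p, (p <= n)%N -> [/\ bm (A p), bm (D p) & \int[P]_w A p w = 0],
      forall p m, (p <= n)%N -> (0 < m)%N -> Lm P m (A p) <= bconst R m *
        ((Num.sqrt N%:R)^-1 * (2 * (qk M G p (n - p) * betak M G p (n - p)))) &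
      forall p m, (p <= n)%N -> (0 < m)%N -> Lm P m (D p) <= bconst R (2 * m) ^+ 2 *
        (N%:R^-1 * (4 * (qk M G p (n - p) ^+ 3 * betak M G p (n - p))))].
Proof.
move=> f1.
have /choice[AD hAD] p : exists AD : (Omega -> R) * (Omega -> R), (p <= n)%N ->
   [/\ bm AD.1 /\ bm AD.2,
      forall w, eta_N p w (back n f p) / eta_N p w (back n (fun=> 1) p)
        - predicted p w (back n f p) / predicted p w (back n (fun=> 1) p)
        = AD.1 w - AD.2 w,
      \int[P]_w AD.1 w = 0,
      forall m, (0 < m)%N -> Lm P m AD.1 <= bconst R m *
        ((Num.sqrt N%:R)^-1 * (2 * (qk M G p (n - p) * betak M G p (n - p)))) &
      forall m, (0 < m)%N -> Lm P m AD.2 <= bconst R (2 * m) ^+ 2 *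
        (N%:R^-1 * (4 * (qk M G p (n - p) ^+ 3 * betak M G p (n - p))))].
  (* [choice] asks for a pair at every [p]; beyond [n] zero functions fill in. *)
  case: (boolP (p <= n)%N) => [pn|_]; last by exists (fun=> 0, fun=> 0).
  have [f' f'1 ->] := back_Osc1 pn f1; rewrite back1//.
  by have [A [D H]] := local_error (p := p) f'1; exists (A, D).
exists (fun p => (AD p).1), (fun p => (AD p).2); split.
- move=> w; rewrite telescope; apply: eq_bigr => -[p /= pn] _.
  by case: (hAD p pn) => _ ->.
- by move=> p pn; case: (hAD p pn) => -[].
- by move=> p m pn m0; case: (hAD p pn) => _ _ _ + _; apply.
- by move=> p m pn m0; case: (hAD p pn) => _ _ _ _; apply.
Qed.

Lemma bm_emp n (f : S n -> R) : bm f -> bm (fun w => eta_N n w f).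
Proof.
move=> bf; apply: bmZ; apply: bm_sum => i _.
exact: (bm_comp (X_meas n i) bf).
Qed.

(** The centred parts vanish in expectation, so only the remainders [D p] count. They are bounded in
    [L^1], where the constant [b(2)^2] equals 1. *)
Lemma particle_bias n f : Osc1 f ->
  N%:R * `|\int[P]_w (eta_N n w f) - eta_flow M G eta0 n f| <= sigma1 M G n.
Proof.
move=> f1; have [A [D [AD bAD _ LD]]] := error_decomposition f1.
have -> : \int[P]_w (eta_N n w f) - eta_flow M G eta0 n f =
    - \sum_(p < n.+1) \int[P]_w D p w.
  rewrite -{1}(Ex_cst P1 (eta_flow M G eta0 n f)) -ExB//; [|by apply: bm_emp; exact: Osc1_bm|exact: bm_cst].
  rewrite (eq_Ex _ AD) Ex_sum//; last first.
    by move=> [p /= pn] _; case: (bAD p pn) => bA bD _; exact: bmB.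
  rewrite -sumrN; apply: eq_bigr => -[p /= pn] _; case: (bAD p pn) => bA bD EA.
  by rewrite ExB// EA sub0r.
have N0 : 0 < N%:R :> R by rewrite ltr0n.
rewrite normrN -ler_pdivlMl// /sigma1 mulrA mulr_sumr.
apply: le_trans (ler_norm_sum _ _ _) _; apply: ler_sum => -[p /= pn] _.
have [_ bD _] := bAD p pn.
apply: le_trans (le_norm_Ex P1 bD) _.
have := LD p 1 pn isT; rewrite muln1 bconst2 expr1n mul1r.
by rewrite /Lm invr1 powRr1 ?mulrA//; apply: Ex_ge0 => w; exact: exprn_ge0.
Qed.

(** The terms [A p] are of order [N^{-1/2}] and the [D p] of order [N^{-1}]; after multiplication by
    [sqrt N] only the latter keep a vanishing factor. *)
Lemma particle_Lm n f m : Osc1 f -> (0 < m)%N ->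
  Num.sqrt N%:R * Lm P m (fun w => eta_N n w f - eta_flow M G eta0 n f) <=
  (Num.sqrt N%:R)^-1 * bconst R (2 * m) ^+ 2 * sigma1 M G n + bconst R m * sigma2 M G n.
Proof.
move=> f1 m0; have [A [D [AD bAD LA LD]]] := error_decomposition f1.
have s0 : 0 < Num.sqrt N%:R :> R by rewrite sqrtr_gt0 ltr0n.
have sE : N%:R^-1 = (Num.sqrt N%:R)^-1 * (Num.sqrt N%:R)^-1 :> R.
  by rewrite -invfM -expr2 sqr_sqrtr.
rewrite (_ : (fun w => _) = (fun w => \sum_(p < n.+1) (A p w - D p w))); last first.
  by apply/funext => w; exact: AD.
rewrite -ler_pdivlMl//.
apply: le_trans (Lm_minkowski_sum P1 (F := fun p w => A p w - D p w) (a := fun p =>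
    bconst R m * ((Num.sqrt N%:R)^-1 * (2 * (qk M G p (n - p) * betak M G p (n - p)))) +
    bconst R (2 * m) ^+ 2 * (N%:R^-1 * (4 * (qk M G p (n - p) ^+ 3 * betak M G p (n - p)))))
    m0 _) _.
  move=> p pn; have [bA bD _] := bAD p pn; split; first exact: bmB.
  apply: Lm_minkowski => //; [exact: bmN|exact: LA|].
  by rewrite LmN; exact: LD.
rewrite big_split /= le_eqVlt; apply/orP; left; apply/eqP.
rewrite /sigma1 /sigma2 sE !mulrDr addrC !mulr_sumr.
by congr (_ + _); apply: eq_bigr => p _; ring.
Qed.

End particles.
End feynman_kac.

Unset Implicit Arguments.
Set Strict Implicit.

Theorem theorem4p4 (R : realType) (d : nat -> measure_display)
  (S : forall n, measurableType (d n))
  (eta0 : probability (S 0) R)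
  (M : forall n, R.-pker (S n) ~> (S n.+1))
  (G : forall n, S n -> R)
  (G_meas : forall n, measurable_fun [set: S n] (G n))
  (G_01 : forall n x, 0 < G n x < 1)
  (q_fin : forall n, exists q : R, forall x y, G n x / G n y <= q)
  (N : nat) (N_ge1 : (1 <= N)%N)
  (dO : measure_display) (Omega : measurableType dO)
  (P : probability Omega R)
  (X : forall n, 'I_N -> Omega -> S n)
  (X_meas : forall n i, measurable_fun [set: Omega] (X n i))
  (X_init : forall A : 'I_N -> set (S 0), (forall i, measurable (A i)) ->
     P (\bigcap_(i in [set: 'I_N]) (X 0 i @^-1` A i))
     = (\prod_(i < N) eta0 (A i))%E)
  (X_step : forall n (A : 'I_N -> set (S n)) (B : 'I_N -> set (S n.+1)),
     (forall i, measurable (A i)) -> (forall i, measurable (B i)) ->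
     P (\bigcap_(i in [set: 'I_N]) (X n i @^-1` A i `&` X n.+1 i @^-1` B i))
     = (\int[P]_w (\prod_(i < N)
           (\1_(A i) (X n i w) * Kemp M G n (fun j => X n j w) (X n i w) (B i)))%:E)%E)
  (n : nat) (f : S n -> R) (hf : Osc1 f) :
  N%:R * `| fine (\int[P]_w (emp (fun j => X n j w) f)%:E) - eta_flow M G eta0 n f |
    <= sigma1 M G n
  /\
  forall m : nat, (1 <= m)%N ->
    Num.sqrt N%:R *
      fine (\int[P]_w (`| emp (fun j => X n j w) f - eta_flow M G eta0 n f | ^+ m)%:E)
        `^ (m%:R^-1)
    <= (Num.sqrt N%:R)^-1 * (bconst R (2 * m)) ^+ 2 * sigma1 M G n
       + bconst R m * sigma2 M G n.
Proof.
case: N N_ge1 X X_meas X_init X_step => [//|N'] _ X X_meas X_init X_step.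
(* [fine] of the extended integral is by definition the real integral of the preceding lemmas. *)
split; first exact: (particle_bias G_meas G_01 q_fin X_meas X_init X_step hf).
by move=> m m1; exact: (particle_Lm G_meas G_01 q_fin X_meas X_init X_step hf m1).
Qed.
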